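(* There exist commutative coherent configurations that prove the s-rank exponent bounds $\omega_s\le 2.48$, $\omega_s\le 2.41$, and $\omega_s\le 2.376$, and thus corresponding exponent bounds $\omega\le 2.72$, $\omega\le 2.62$, and $\omega\le 2.564$, respectively. That is, for each $c\in\{2.48,\,2.41,\,2.376\}$ there is a family of commutative coherent configurations that proves $\omega_s\le c$.
   Context: Write $[n]=\{1,\dots,n\}$. A coherent configuration of rank $r$ is a finite set $\mathcal{C}$ (of points) with a partition of $\mathcal{C}^2$ into subsets $R_1,\dots,R_r$ (nonempty, called classes) such that: (1) the diagonal is a union of some of the classes; (2) for each $i\in[r]$ there is $i^*\in[r]$ with $\{(b,a):(a,b)\in R_i\}=R_{i^*}$; (3) there are integers $p^k_{i,j}$ such that for all $i,j,k\in[r]$ and all $(x,y)\in R_k$, $\#\{z\in\mathcal{C}:(x,z)\in R_i,\ (z,y)\in R_j\}=p^k_{i,j}$. It is commutative if $p^k_{i,j}=p^k_{j,i}$ for all $i,j,k$. Three classes $i,j,k$ form a triangle if there exist points $x,y,z$ with $(x,y)\in R_i$, $(y,z)\in R_j$, $(z,x)\in R_k$. $\mathcal{C}$ realizes $\langle\ell,m,n\rangle$ if there are injective functions $\alpha:[\ell]\times[m]\to[r]$, $\beta:[m]\times[n]\to[r]$, $\gamma:[n]\times[\ell]\to[r]$ such that $\alpha(a,b'),\beta(b,c'),\gamma(c,a')$ form a triangle iff $a=a'$, $b=b'$, $c=c'$. Exponents: a third-order tensor over $\mathbb{C}$ is a trilinear form $T=\sum T_{i,j,k}\hat x_i\hat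 y_j\hat z_k$ in formal variables; its rank $R(T)$ is the least number of products of linear forms $\alpha(\hat x)\beta(\hat y)\gamma(\hat z)$ summing to $T$; its s-rank $R_s(T)$ is the minimum rank of a tensor in the same variables having the same set of monomials with nonzero coefficient. With $\langle n,n,n\rangle=\sum_{i,j,k\in[n]}\hat x_{i,j}\hat y_{j,k}\hat z_{k,i}$, $\omega=\inf\{\tau\in\mathbb{R}:R(\langle n,n,n\rangle)=O(n^\tau)\}$ and $\omega_s=\inf\{\tau\in\mathbb{R}:R_s(\langle n,n,n\rangle)=O(n^\tau)\}$. Meaning of ''prove'': if a commutative coherent configuration $\mathcal{D}$ realizes $\langle L,M,N\rangle$ then $(LMN)^{\omega_s/3}\le \mathrm{rank}(\mathcal{D})$. A family $\mathcal{F}$ of commutative coherent configurations proves a bound $P(\omega_s)$ if these inequalities imply it (possibly in the limit over the family): for every real $\tau$ such that $(LMN)^{\tau/3}\le\mathrm{rank}(\mathcal{D})$ for all $\mathcal{D}\in\mathcal{F}$ and all positive integers $L,M,N$ for which $\mathcal{D}$ realizes $\langle L,M,N\rangle$, the statement $P(\tau)$ holds. The corresponding bound on $\omega$ is the one obtained from $\omega\le(3\omega_s-2)/2$. *)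

(* Defs.v *)
From HB Require Import structures.
From mathcomp Require Import all_boot all_order all_algebra.
From mathcomp Require Import all_classical all_reals all_analysis.
From mathcomp Require Import complex.
Set Implicit Arguments.
Unset Strict Implicit.
Unset Printing Implicit Defensive.
Import Order.TTheory GRing.Theory Num.Theory.
Import numFieldNormedType.Exports.
Local Open Scope ring_scope.

(* The classes are indexed by 'I_cc_rank. Since every class is nonempty, the
   intersection numbers cc_inum i j k (= p^k_{i,j}) are determined by the
   classes, so keeping them as a field adds no structure. *)
Record coherent_configuration := CoherentConfiguration {
  cc_point : finType;
  cc_rank : nat;
  cc_class : 'I_cc_rank -> {set cc_point * cc_point};
  cc_inum : 'I_cc_rank -> 'I_cc_rank -> 'I_cc_rank -> nat;
  cc_class_neq0 : forall i, cc_class i != finset.set0;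
  cc_class_partition : forall p, exists! i, p \in cc_class i;
  cc_diagonal : exists S : {set 'I_cc_rank},
    forall x y, (x == y) = [exists i in S, (x, y) \in cc_class i];
  cc_transpose : forall i, exists i',
    forall a b, ((a, b) \in cc_class i) = ((b, a) \in cc_class i');
  cc_inumP : forall i j k x y, (x, y) \in cc_class k ->
    #|[pred z | ((x, z) \in cc_class i) && ((z, y) \in cc_class j)]|
      = cc_inum i j k
}.

Definition cc_commutative (D : coherent_configuration) : Prop :=
  forall i j k : 'I_(cc_rank D), cc_inum i j k = cc_inum j i k.

Definition cc_triangle (D : coherent_configuration)
    (i j k : 'I_(cc_rank D)) : Prop :=
  exists x y z : cc_point D,
    [/\ (x, y) \in cc_class i, (y, z) \in cc_class j & (z, x) \in cc_class k].

Definition realizes (D : coherent_configuration) (l m n : nat) : Prop :=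
  exists (alpha : 'I_l * 'I_m -> 'I_(cc_rank D))
         (beta : 'I_m * 'I_n -> 'I_(cc_rank D))
         (gamma : 'I_n * 'I_l -> 'I_(cc_rank D)),
    [/\ injective alpha, injective beta, injective gamma
      & forall (a a' : 'I_l) (b b' : 'I_m) (c c' : 'I_n),
          cc_triangle (alpha (a, b')) (beta (b, c')) (gamma (c, a'))
          <-> [/\ a = a', b = b' & c = c']].

Section ProvingBounds.
Variable R : realType.
Implicit Types (F : coherent_configuration -> Prop) (tau w : R).

Definition satisfies_inequalities F tau : Prop :=
  forall D, F D -> forall L M N : nat,
    (0 < L)%N -> (0 < M)%N -> (0 < N)%N -> realizes D L M N ->
    (L * M * N)%:R `^ (tau / 3) <= (cc_rank D)%:R.

Definition proves_s_rank_bound F (P : R -> Prop) : Prop :=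
  forall tau, satisfies_inequalities F tau -> P tau.

(* tau stands for omega_s and w for omega, which are related by
   omega <= (3 omega_s - 2) / 2. *)
Definition proves_omega_bound F (Q : R -> Prop) : Prop :=
  forall tau w,
    satisfies_inequalities F tau -> w <= (3 * tau - 2) / 2 -> Q w.

End ProvingBounds.

(* The minimum of P; junk value 0 if P is empty. *)
Definition nat_min (P : set nat) : nat :=
  xget 0%N [set r | P r /\ forall s, P s -> (r <= s)%N]%classic.

Section Exponents.
Variable R : realType.

(* A third-order tensor is given by its coefficients T i j k, in variables
   x_i, y_j, z_k indexed by finite types. *)
Section Tensors.
Variables X Y Z : finType.
Implicit Types T : X -> Y -> Z -> R[i].

Definition sum_of_products T (r : nat) : Prop :=
  exists (u : 'I_r -> X -> R[i]) (v : 'I_r -> Y -> R[i])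
         (w : 'I_r -> Z -> R[i]),
    forall i j k, T i j k = \sum_(t < r) u t i * v t j * w t k.

Definition tensor_rank T : nat := nat_min (sum_of_products T).

Definition same_support T T' : Prop :=
  forall i j k, (T i j k != 0) = (T' i j k != 0).

Definition tensor_s_rank T : nat :=
  nat_min [set r | exists2 T', same_support T T' & r = tensor_rank T']%classic.

End Tensors.

Definition matmul_tensor (n : nat) (x y z : 'I_n * 'I_n) : R[i] :=
  ((x.2 == y.1) && (y.2 == z.1) && (z.2 == x.1))%:R.

Definition growth_exponent (f : nat -> nat) : R :=
  inf [set tau : R | (fun n => (f n)%:R : R^o)
                       =O_\oo (fun n => n%:R `^ tau : R^o)]%classic.

Definition omega : R :=
  growth_exponent (fun n => tensor_rank (@matmul_tensor n)).

Definition omega_s : R :=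
  growth_exponent (fun n => tensor_s_rank (@matmul_tensor n)).

End Exponents.

(* Main.v *)
(** The Coppersmith-Winograd construction, in its second tensor power, can be carried out
    with abelian groups and then with symmetric powers of them.

    A family of triples of subsets (A_i, B_i, C_i) of a finite abelian group G with the
    simultaneous triple product property, |A_i| |B_i| |C_i| = V and indexed by a set of size
    k yields a single matrix multiplication, of volume V^k, in the commutative coherent
    configuration on G^k whose classes are the multisets of coordinates of y - x. Its rank
    is at most binomial(|G| + k - 1, k), so the hypothesis on tau becomes
    k V^(tau/3) <= 8 |G|.

    Take G = ((Z/8)^2)^n and grade Z/8 by the level 0, 1 or 2 of an element, according to
    whether it is 0, neither 0 nor 1, or 1. Triples with x + y + z = 0 have total level at
    least 2, and those of level exactly 2 form the Coppersmith-Winograd tensor. Prescribing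
    how often each level of a pair occurs forces equality in every coordinate. Hashing into
    (Z/m)^q and keeping the values in a progression-free set isolates level patterns; this
    is done once for the levels of the pairs and once more, inside the blocks of type
    (1,1,2), for the levels of their first components. With the integer weights below the
    resulting inequality fails for tau > 2.376, which gives all three bounds. *)
From HB Require Import structures.
Require Import Defs.
From mathcomp Require Import all_boot all_order all_algebra.
From mathcomp Require Import all_classical all_reals all_analysis.
From mathcomp Require Import fingroup perm.
From mathcomp Require Import zify ring lra.
Set Implicit Arguments.
Unset Strict Implicit.
Unset Printing Implicit Defensive.
Import Order.TTheory GRing.Theory Num.Theory.
Local Open Scope ring_scope.

(** * Symmetric powers of abelian groups *)

Section SymmetricPower.
Variables (G : finZmodType) (k : nat).
Implicit Types (u v w x y z : {ffun 'I_k -> G}) (s : {perm 'I_k}).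

Definition content v : {ffun G -> 'I_k.+1} :=
  [ffun g => inord #|[pred j | v j == g]|].

Definition permuted v s : {ffun 'I_k -> G} := [ffun j => v (s j)].

Lemma content_permuted v s : content (permuted v s) = content v.
Proof.
apply/ffunP => g; rewrite !ffunE; congr inord.
rewrite -[RHS](on_card_preimset (onW_bij _ (injF_bij (@perm_inj _ s)))).
by rewrite cardsE; apply: eq_card => j; rewrite !inE ffunE.
Qed.

Lemma content_eqP v w : content v = content w -> exists s, v = permuted w s.
Proof.
move=> e.
pose t1 := [tuple v j | j < k]; pose t2 := [tuple w j | j < k].
have cnt u g : count_mem g [tuple u j | j < k] = content u g.
  rewrite ffunE inordK; last by rewrite ltnS -[X in (_ <= X)%N]card_ord max_card.
  rewrite /= count_map -sum1_count -sum1_card big_enum_cond /=.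
  by apply: eq_bigl => j; rewrite !inE.
have /tuple_permP[s es] : perm_eq t1 t2.
  by apply/allP => g _ /=; rewrite !cnt e.
exists s; apply/ffunP => j; rewrite ffunE.
have := congr1 (fun t => tnth t j) (val_inj es : t1 = [tuple tnth t2 (s i) | i < k]).
by rewrite !tnth_mktuple.
Qed.

Definition contents := [set content v | v : {ffun 'I_k -> G}].

(** A content is a tuple of [#|G|] multiplicities with sum [k], and such tuples are counted by stars
    and bars. *)
Lemma card_contents : (#|contents| <= 'C(#|G|.-1 + k, k))%N.
Proof.
have G0 : (0 < #|G|)%N by apply/card_gt0P; exists 0.
have e : #|G|.-1.+1 = #|G| by rewrite prednK.
pose f (c : {ffun G -> 'I_k.+1}) : #|G|.-1.+1.-tuple 'I_k.+1 :=
  [tuple c (enum_val (cast_ord e i)) | i < #|G|.-1.+1].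
have finj : injective f.
  move=> c c' /(congr1 (fun t => tnth t)) ef; apply/ffunP => g.
  have := congr1 (fun h => h (cast_ord (esym e) (enum_rank g))) ef.
  by rewrite !tnth_mktuple cast_ordKV enum_rankK.
rewrite -bin_sub ?leq_addl // addnK -card_ord_partitions -(card_imset _ finj).
apply: subset_leq_card; apply/fintype.subsetP => _ /imsetP[_ /imsetP[v _ ->] ->].
rewrite inE big_map big_enum /=.
under eq_bigr => i _ do rewrite ffunE.
rewrite (reindex (fun g => cast_ord (esym e) (enum_rank g))) /=; last first.
  exists (fun i => enum_val (cast_ord e i)) => i _ /=.
    by rewrite cast_ordKV enum_rankK.
  by rewrite enum_valK cast_ordK.
under eq_bigr => i _ do rewrite cast_ordKV enum_rankK.
apply/eqP; transitivity (\sum_(g : G) #|[pred j | v j == g]|)%N.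
  apply: eq_bigr => g _; rewrite inordK //.
  by rewrite ltnS -[X in (_ <= X)%N]card_ord max_card.
rewrite -[RHS](card_ord k) -[RHS]sum1_card (partition_big v predT) //=.
by apply: eq_bigr => g _; rewrite -sum1_card; apply: eq_bigl => j; rewrite !inE.
Qed.

Lemma content_in v : content v \in contents.
Proof. exact: imset_f. Qed.

Definition sym_index v : 'I_#|contents| := enum_rank_in (content_in v) (content v).

Lemma sym_indexE v w : (sym_index v = sym_index w) <-> (content v = content w).
Proof.
split=> [/(congr1 enum_val)|e]; first by rewrite !enum_rankK_in ?content_in.
by apply: enum_val_inj; rewrite !enum_rankK_in ?content_in.
Qed.

Definition sym_class (i : 'I_#|contents|) : {set {ffun 'I_k -> G} * {ffun 'I_k -> G}} :=
  [set p : {ffun 'I_k -> G} * {ffun 'I_k -> G} | sym_index (p.2 - p.1) == i].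

Lemma sym_index_surj i : {v | sym_index v == i}.
Proof.
apply: sigW; have /imsetP[v _ e] := enum_valP i.
exists v; apply/eqP/enum_val_inj; rewrite enum_rankK_in ?content_in //.
Qed.

Definition sym_repr i := sval (sym_index_surj i).

Lemma sym_reprK i : sym_index (sym_repr i) = i.
Proof. by apply/eqP; exact: (svalP (sym_index_surj i)). Qed.

(** Here [u] stands for [z - x], counted for one fixed representative of the class [l]. *)
Definition sym_inum (i j l : 'I_#|contents|) : nat :=
  #|[pred u | (sym_index u == i) && (sym_index (sym_repr l - u) == j)]|.

Lemma sym_class_neq0 i : sym_class i != finset.set0.
Proof.
apply/finset.set0Pn; exists (0, sym_repr i).
by rewrite inE /= subr0 sym_reprK.
Qed.

Lemma sym_class_partition p : exists! i, p \in sym_class i.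
Proof.
exists (sym_index (p.2 - p.1)); split; first by rewrite inE.
by move=> i; rewrite inE => /eqP.
Qed.

Lemma permuted0 s : permuted 0 s = 0.
Proof. by apply/ffunP => j; rewrite !ffunE. Qed.

Lemma sym_index0 v : sym_index v = sym_index 0 <-> v = 0.
Proof.
split=> [/sym_indexE/content_eqP[s]|-> //].
by rewrite permuted0.
Qed.

Lemma sym_diagonal : exists S : {set 'I_#|contents|},
  forall x y, (x == y) = [exists i in S, (x, y) \in sym_class i].
Proof.
exists [set sym_index 0]%SET => x y; apply/eqP/existsP => [->|[i]].
  by exists (sym_index 0); rewrite !inE eqxx /= subrr.
rewrite !inE /= => /andP[/eqP-> /eqP/sym_index0/eqP].
by rewrite subr_eq0 => /eqP.
Qed.

Lemma sym_index_opp v w : sym_index v = sym_index w -> sym_index (- v) = sym_index (- w).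
Proof.
move=> /sym_indexE/content_eqP[s ->]; apply/sym_indexE.
rewrite -(content_permuted (- w) s); congr content.
by apply/ffunP => j; rewrite !ffunE.
Qed.

Lemma sym_transpose i : exists i',
  forall a b, ((a, b) \in sym_class i) = ((b, a) \in sym_class i').
Proof.
exists (sym_index (- sym_repr i)) => a b; rewrite !inE /=.
apply/eqP/eqP => [e|/sym_index_opp].
  by rewrite -opprB; apply: sym_index_opp; rewrite e sym_reprK.
by rewrite opprB opprK sym_reprK.
Qed.

(** If [s] carries [y - x] to the representative of [l], then [z |-> permuted (z - x) s] is a
    bijection that preserves the contents of both [z - x] and [y - z]. *)
Lemma sym_inumP i j l x y : (x, y) \in sym_class l ->
  #|[pred z | ((x, z) \in sym_class i) && ((z, y) \in sym_class j)]|
    = sym_inum i j l.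
Proof.
rewrite inE /= => /eqP e.
have /content_eqP[s es] : content (sym_repr l) = content (y - x).
  by apply/sym_indexE; rewrite sym_reprK.
pose h z := permuted (z - x) s.
have hinj : injective h.
  move=> z z' ehz; apply: (addIr (- x)); apply/ffunP => a.
  by have /ffunP/(_ (s^-1%g a)) := ehz; rewrite !ffunE permKV.
rewrite /sym_inum; have hbij := injF_bij hinj.
rewrite -[RHS](on_card_preimset (onW_bij _ hbij)).
rewrite cardsE; apply: eq_card => z; rewrite !inE /=; congr andb.
  by congr eq_op; apply/sym_indexE; rewrite content_permuted.
congr eq_op; apply/sym_indexE; rewrite es.
rewrite -(content_permuted (y - z) s); congr content.
by apply/ffunP => a; rewrite !ffunE opprB addrA subrK.
Qed.

Definition symmetric_power := @CoherentConfiguration _ _ sym_class sym_inum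
  sym_class_neq0 sym_class_partition sym_diagonal sym_transpose sym_inumP.

(** The reflection [u |-> sym_repr l - u] exchanges the two conditions counted by [sym_inum]. *)
Lemma symmetric_power_commutative : cc_commutative symmetric_power.
Proof.
move=> i j l; rewrite /= /sym_inum.
have hinj : injective (fun u => sym_repr l - u) by move=> u v /addrI/oppr_inj.
rewrite -[RHS](on_card_preimset (onW_bij _ (injF_bij hinj))).
rewrite cardsE; apply: eq_card => z; rewrite !inE /= andbC; congr (_ && _).
by rewrite opprB addrCA subrr addr0.
Qed.

End SymmetricPower.

(** * Simultaneous triple product families and the inequality that they yield *)

Section SimultaneousTripleProduct.
Variable G : finZmodType.

Definition stpp (I : finType) (A B C : I -> {set G}) : Prop :=
  forall i j k a b b' c c' a',
    a \in A i -> b \in B i -> b' \in B j -> c \in C j -> c' \in C k -> a' \in A k ->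
    (a - b) + (b' - c) + (c' - a') = 0 ->
    [/\ i = j, j = k, a = a', b = b' & c = c'].

Lemma stpp_rot (I : finType) (A B C : I -> {set G}) : stpp A B C -> stpp B C A.
Proof.
move=> H i j k b c c' a a' b' hb hc hc' ha ha' hb' e.
have [] := H k i j a' b' b c c' a ha' hb' hb hc hc' ha.
  by rewrite -[RHS]e [RHS]addrC [RHS]addrA.
by move=> -> -> -> -> ->.
Qed.

(** The property is applied with [j] in the last two positions and with a single [c] from [C j],
    which cancels. *)
Lemma stpp_inj (I : finType) (A B C : I -> {set G}) :
  stpp A B C -> (forall i, C i != finset.set0) ->
  forall i j a b a' b', a \in A i -> b \in B i -> a' \in A j -> b' \in B j ->
  a - b = a' - b' -> [/\ i = j, a = a' & b = b'].
Proof.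
move=> H C0 i j a b a' b' ha hb ha' hb' e.
have /finset.set0Pn[c hc] := C0 j.
have [|-> _ -> -> _] // := H i j j a b b' c c a' ha hb hb' hc hc ha'.
by rewrite e subrKA subrKA subrr.
Qed.

Section Realize.
Variables (k : nat) (A B C : 'I_k -> {set G}).

Definition family_set (A : 'I_k -> {set G}) : {set {ffun 'I_k -> G}} :=
  [set v : {ffun 'I_k -> G} | [forall i, v i \in A i]].

Lemma card_family_set (A' : 'I_k -> {set G}) : #|family_set A'| = (\prod_i #|A' i|)%N.
Proof.
rewrite cardsE; transitivity #|family A'|.
  by apply: eq_card => v; rewrite !inE.
by rewrite card_family foldrE big_map big_enum.
Qed.

Lemma family_setP (A' : 'I_k -> {set G}) (p : 'I_#|family_set A'|) i : enum_val p i \in A' i.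
Proof. by have := enum_valP p; rewrite inE => /forallP. Qed.

Definition diff_index (A' B' : 'I_k -> {set G}) (p : 'I_#|family_set A'| * 'I_#|family_set B'|)
  : 'I_#|contents G k| := sym_index (enum_val p.1 - enum_val p.2).

(** Equal contents give a permutation that matches the coordinatewise differences. The index of a
    triple is its coordinate, so the triple product property forces this permutation to be the
    identity. *)
Lemma diff_index_inj (A' B' C' : 'I_k -> {set G}) :
  stpp A' B' C' -> (forall i, C' i != finset.set0) -> injective (@diff_index A' B').
Proof.
move=> H C0 [a b] [a' b'] /sym_indexE/content_eqP[s /= e].
have key j : [/\ j = s j, enum_val a j = enum_val a' (s j)
                   & enum_val b j = enum_val b' (s j)].
  have /ffunP/(_ j) := e; rewrite !ffunE.
  by apply: (stpp_inj H C0); exact: family_setP.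
have sj j : s j = j by have [/esym] := key j.
have -> : a = a' by apply/enum_val_inj/ffunP => j; have [_ -> _] := key j; rewrite sj.
have -> // : b = b'.
by apply/enum_val_inj/ffunP => j; have [_ _ ->] := key j; rewrite sj.
Qed.

Lemma stpp_realizes : stpp A B C ->
  (forall i, A i != finset.set0) -> (forall i, B i != finset.set0) ->
  (forall i, C i != finset.set0) ->
  realizes (symmetric_power G k) #|family_set A| #|family_set B| #|family_set C|.
Proof.
move=> H A0 B0 C0.
exists (@diff_index A B), (@diff_index B C), (@diff_index C A); split.
- exact: diff_index_inj H C0.
- exact: diff_index_inj (stpp_rot H) A0.
- exact: diff_index_inj (stpp_rot (stpp_rot H)) B0.
move=> a a' b b' c c'; split=> [[x [y [z]]]|[-> -> ->]]; last first.
  (* The successive differences around this triangle are [a' - b'], [b' - c'] and [c' - a']. *)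
  exists 0, (enum_val a' - enum_val b'), (enum_val a' - enum_val c').
  rewrite !inE /diff_index /= subr0 sub0r !opprB; split => //.
  by rewrite [_ - _ + _]addrC subrKA.
rewrite !inE /= => -[/eqP/sym_indexE/content_eqP[s1 e1]
  /eqP/sym_indexE/content_eqP[s2 e2] /eqP/sym_indexE/content_eqP[s3 e3]].
(* The sides of a triangle sum to zero in every coordinate. This makes the three permutations
   coincide; their common value, which may be arbitrary, is then undone by reindexing with its
   inverse. *)
have key j : [/\ s1 j = s2 j, s2 j = s3 j, enum_val a (s1 j) = enum_val a' (s3 j),
    enum_val b' (s1 j) = enum_val b (s2 j) & enum_val c' (s2 j) = enum_val c (s3 j)].
  apply: H; try exact: family_setP.
  move/ffunP/(_ j): e1; move/ffunP/(_ j): e2; move/ffunP/(_ j): e3.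
  rewrite !ffunE /= => <- <- <-.
  by rewrite [_ + (z j - y j)]addrC !subrKA subrr.
split; apply/enum_val_inj/ffunP => j.
- have [e12 e23 ea _ _] := key (s1^-1 j)%g.
  by move: ea; rewrite -e23 -e12 permKV.
- have [e12 _ _ eb _] := key (s1^-1 j)%g.
  by move: eb; rewrite -e12 permKV.
- have [_ e23 _ _ ec] := key (s2^-1 j)%g.
  by move: ec; rewrite -e23 permKV.
Qed.

End Realize.

Lemma stpp_card (I : finType) (A B C : I -> {set G}) : stpp A B C ->
  (forall i, A i != finset.set0) -> (forall i, B i != finset.set0) ->
  (forall i, C i != finset.set0) -> (#|I| <= #|G|)%N.
Proof.
move=> H A0 B0 C0.
have a i := xchooseP (finset.set0Pn _ (A0 i)).
have b i := xchooseP (finset.set0Pn _ (B0 i)).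
apply: (@leq_card _ _ (fun i => xchoose (finset.set0Pn _ (A0 i))
                               - xchoose (finset.set0Pn _ (B0 i)))).
by move=> i j /(stpp_inj H C0 (a i) (b i) (a j) (b j))[].
Qed.

End SimultaneousTripleProduct.

(** The quotient of [k ^ k] by the factorial is a single term of the series of [expR k]. *)
Lemma expn_le_fact (R : realType) (k : nat) : k%:R ^+ k <= k`!%:R * expR 1 ^+ k :> R.
Proof.
case: k => [|k]; first by rewrite !expr0 fact0 mulr1.
have h : 0 <= k.+1%:R :> R by [].
have := expR_ge1Dxn k h.
rewrite -expRM_natr mul1r => h2.
have : k.+1%:R ^+ k.+1 / (k.+1)`!%:R <= expR k.+1%:R :> R by lra.
by rewrite ler_pdivrMr ?ltr0n ?fact_gt0 // mulrC.
Qed.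

Lemma expR1_le4 (R : realType) : expR 1 <= 4 :> R.
Proof.
have h : 2^-1 <= expR (- 2^-1) :> R.
  by have := expR_ge1Dx (- 2^-1 : R); lra.
have : 4^-1 <= expR (-1) :> R.
  have -> : -1 = 2%:R * (- 2^-1) :> R by field.
  rewrite expRM_natl; have -> : 4^-1 = (2^-1)^+2 :> R by field.
  by rewrite lerXn2r // nnegrE ?expR_ge0.
by rewrite expRN lef_pV2 // posrE ?expR_gt0.
Qed.


(** With [v = V ^ (tau / 3)] and [k = #|I|], the rank bound says that [v ^ k] times the factorial of
    [k] is at most [(#|G| + k - 1) ^ k]. Combining this with [expn_le_fact] and taking [k]-th roots
    gives [k v <= e (#|G| + k - 1)]. The factor 8 comes from [k <= #|G|] and [e <= 4]. *)
Lemma stpp_bound (R : realType) (tau : R) (G : finZmodType) (I : finType)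
    (A B C : I -> {set G}) (V : nat) :
  satisfies_inequalities cc_commutative tau -> stpp A B C ->
  (forall i, #|A i| * #|B i| * #|C i| = V)%N -> (0 < V)%N -> (0 < #|I|)%N ->
  #|I|%:R * V%:R `^ (tau / 3) <= 8 * #|G|%:R.
Proof.
move=> Htau H vol V0 I0.
have A0 i : (0 < #|A i|)%N by move: V0; rewrite -(vol i) !muln_gt0 => /andP[/andP[]].
have B0 i : (0 < #|B i|)%N by move: V0; rewrite -(vol i) !muln_gt0 => /andP[/andP[]].
have C0 i : (0 < #|C i|)%N by move: V0; rewrite -(vol i) !muln_gt0 => /andP[/andP[]].
have kG : (#|I| <= #|G|)%N.
  by apply: (stpp_card H) => i; rewrite -finset.card_gt0.
set k := #|I|; pose e (i : 'I_k) : I := enum_val i.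
have He : stpp (A \o e) (B \o e) (C \o e).
  move=> i j l a b b' c c' a' ha hb hb' hc hc' ha' s.
  have [/enum_val_inj-> /enum_val_inj-> -> -> ->] // :=
    H _ _ _ _ _ _ _ _ _ ha hb hb' hc hc' ha' s.
have real := stpp_realizes He.
have pos (X : I -> {set G}) : (forall i, 0 < #|X i|)%N ->
    (0 < #|family_set (X \o e)|)%N.
  by move=> X0; rewrite card_family_set; apply: prodn_gt0 => i; exact: X0.
have := Htau _ (@symmetric_power_commutative G k) _ _ _ (pos _ A0) (pos _ B0) (pos _ C0).
move=> /(_ (real _ _ _)).
have -> : (#|family_set (A \o e)| * #|family_set (B \o e)| * #|family_set (C \o e)| = V ^ k)%N.
  rewrite !card_family_set -!big_split /= (eq_bigr (fun=> V)) => [|i _]; last exact: vol.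
  by rewrite prod_nat_const card_ord.
rewrite natrX -powR_mulrn // powRAC powR_mulrn ?powR_ge0 //.
set v := V%:R `^ _ => main.
have {main} le1 : v ^+ k <= 'C(#|G|.-1 + k, k)%:R.
  have nz (X : I -> {set G}) : (forall i, 0 < #|X i|)%N ->
      forall i, (X \o e) i != finset.set0.
    by move=> X0 i; rewrite -finset.card_gt0; exact: X0.
  apply: (le_trans (main (nz _ A0) (nz _ B0) (nz _ C0))).
  by rewrite ler_nat; exact: card_contents.
have v0 : 0 <= v by exact: powR_ge0.
have le2 : v ^+ k * k`!%:R <= (#|G|.-1 + k)%:R ^+ k.
  apply: (le_trans (ler_wpM2r _ le1)) => //.
  rewrite -natrM bin_ffact -natrX ler_nat ffact_prod.
  rewrite -[X in (_ <= _ ^ X)%N]card_ord -prod_nat_const.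
  by apply: leq_prod => i _; exact: leq_subr.
have le3 : (k%:R * v) ^+ k <= ((#|G|.-1 + k)%:R * expR 1) ^+ k.
  rewrite !exprMn.
  apply: (@le_trans _ _ (v ^+ k * k`!%:R * expR 1 ^+ k)).
    by rewrite mulrC -mulrA ler_wpM2l ?exprn_ge0 // expn_le_fact.
  by rewrite ler_wpM2r ?exprn_ge0 ?expR_ge0.
move: le3; rewrite ler_pXn2r // ?nnegrE ?mulr_ge0 ?expR_ge0 // => le3.
apply: (le_trans le3); apply: (@le_trans _ _ ((2 * #|G|)%:R * 4)).
  by rewrite ler_pM ?expR_ge0 ?expR1_le4 // ler_nat; lia.
by rewrite natrM; lra.
Qed.

(** * Induced matchings by hashing *)

Section InducedMatching.
Variables (H : finZmodType) (n : nat).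
Hypothesis torsion_free : forall (h : H) d, (0 < d <= 4)%N -> h *+ d = 0 -> h = 0.
Implicit Types (w : {ffun 'I_n -> H}).

Definition weigh w (a : 'I_n -> nat) : H := \sum_i w i *+ a i.

(** Shifting the [j]-th weight of a solution by every [h] in [H] gives vectors that are distinct for
    distinct pairs of solution and shift, because multiplication by the difference of [a j] and
    [b j] is injective on [H]. *)
Lemma card_weigh_eq (a b : 'I_n -> nat) (j : 'I_n) :
  (a j <= 4)%N -> (b j <= 4)%N -> a j != b j ->
  (#|[set w | weigh w a == weigh w b]| * #|H| <= #|H| ^ n)%N.
Proof.
move=> a4 b4 ab.
pose S := [set w | weigh w a == weigh w b].
pose shift (p : {ffun 'I_n -> H} * H) : {ffun 'I_n -> H} :=
  [ffun i => if i == j then p.1 i + p.2 else p.1 i].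
have weigh_shift p c : weigh (shift p) c = weigh p.1 c + p.2 *+ c j.
  rewrite /weigh (bigD1 j) //= ffunE eqxx mulrnDl [in RHS](bigD1 j) //= addrAC.
  congr (_ + _ + _); apply: eq_bigr => i /negPf ij.
  by rewrite ffunE ij.
have cancel (h : H) : h *+ a j = h *+ b j -> h = 0.
  move=> e; wlog lt_ab : a b a4 b4 ab e {S weigh_shift} / (a j < b j)%N.
    move=> W; case: (ltngtP (a j) (b j)) => [lt|lt|eq].
    - exact: (W a b).
    - by apply: (W b a) => //; rewrite eq_sym.
    - by rewrite eq eqxx in ab.
  apply: (@torsion_free _ (b j - a j)%N); first lia.
  by rewrite mulrnBr 1?ltnW // e subrr.
have inj : {in finset.setX S [set: H] &, injective shift}.
  move=> [w h] [w' h']; rewrite !inE /= !andbT => /eqP e /eqP e' es.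
  have hh : h = h'.
    apply/eqP; rewrite -subr_eq0; apply/eqP/cancel.
    have Ea := weigh_shift (w, h) a; have Eb := weigh_shift (w, h) b.
    have Ea' := weigh_shift (w', h') a; have Eb' := weigh_shift (w', h') b.
    rewrite es in Ea Eb; rewrite Ea' /= in Ea; rewrite Eb' /= in Eb.
    rewrite !mulrnBl.
    have {}Ea : h' *+ a j - h *+ a j = weigh w a - weigh w' a.
      by apply/eqP; rewrite subr_eq addrAC eq_sym subr_eq -Ea addrC.
    have {}Eb : h' *+ b j - h *+ b j = weigh w b - weigh w' b.
      by apply/eqP; rewrite subr_eq addrAC eq_sym subr_eq -Eb addrC.
    by rewrite -opprB Ea e e' -Eb opprB.
  congr (_, _) => //; apply/ffunP => i; move/ffunP/(_ i): es; rewrite !ffunE.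
  by case: eqP => // _; rewrite hh => /addIr.
have <- : #|finset.setX S [set: H]| = (#|S| * #|H|)%N by rewrite cardsX cardsT.
rewrite -(card_in_imset inj).
by rewrite -[X in (_ <= _ ^ X)%N]card_ord -card_ffun max_card.
Qed.

Variables (U : finType) (E T : {set U}) (x y z : U -> 'I_n -> nat) (c : 'I_n -> nat).
Variables (B : {set H}) (D : nat).
Hypothesis TE : T \subset E.
Hypothesis x_le4 : forall e i, (x e i <= 4)%N.
Hypothesis y_le4 : forall e i, (y e i <= 4)%N.
Hypothesis xyz_sum : forall e i, e \in E -> (x e i + y e i + z e i = c i)%N.
Hypothesis xy_inj : forall e e', e \in E -> e' \in E -> x e =1 x e' -> y e =1 y e' -> e = e'.
Hypothesis B_progression_free :
  forall a b d, a \in B -> b \in B -> d \in B -> a + b = d + d -> a = b.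

Definition agree (f : U -> 'I_n -> nat) e e' := [forall i, f e i == f e' i].

Hypothesis degx : forall t, t \in T -> (#|[set e in E | agree x t e]| <= D)%N.
Hypothesis degy : forall t, t \in T -> (#|[set e in E | agree y t e]| <= D)%N.
Hypothesis degz : forall t, t \in T -> (#|[set e in E | agree z t e]| <= D)%N.
Hypothesis H_large : (6 * D <= #|H|)%N.

Let hash := ({ffun 'I_n -> H} * (H * H))%type.
Definition hashx (o : hash) e := weigh o.1 (x e) + o.2.1.
Definition hashy (o : hash) e := weigh o.1 (y e) + o.2.2.
(** Since [x + y + z] is fixed on [E], the sum of the two hashes depends on [z] alone. It serves as
    twice a hash of [z], so no division by 2 is needed. *)
Definition survives (o : hash) e := (hashx o e == hashy o e) && (hashx o e \in B).

Lemma agreeP f e e' : reflect (f e =1 f e') (agree f e e').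
Proof. by apply: (iffP forallP) => h i; apply/eqP; rewrite h. Qed.

Lemma weigh_add w e : weigh w (x e) + weigh w (y e) = \sum_i w i *+ (x e i + y e i).
Proof. by rewrite -big_split; apply: eq_bigr => i _; rewrite mulrnDr. Qed.

Lemma agree_z e e' : e \in E -> e' \in E -> z e =1 z e' ->
  forall i, (x e i + y e i = x e' i + y e' i)%N.
Proof.
by move=> he he' ze i; have := xyz_sum i he; have := xyz_sum i he'; rewrite ze; lia.
Qed.

Lemma hash_add o e e' : e \in E -> e' \in E -> z e =1 z e' ->
  hashx o e + hashy o e = hashx o e' + hashy o e'.
Proof.
move=> he he' ze; rewrite /hashx /hashy !addrA.
rewrite [_ + o.2.1 + _]addrAC [in RHS](addrAC _ o.2.1) !weigh_add.
by congr (_ + _ + _); apply: eq_bigr => i _; rewrite (agree_z he he' ze).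
Qed.

Lemma card_survives e : (#|B| * #|H| ^ n <= #|[set o | survives o e]|)%N.
Proof.
pose f (q : H * {ffun 'I_n -> H}) : hash :=
  (q.2, (q.1 - weigh q.2 (x e), q.1 - weigh q.2 (y e))).
have finj : injective f.
  by move=> [b w] [b' w'] [-> /addIr->].
have <- : #|finset.setX B [set: {ffun 'I_n -> H}]| = (#|B| * #|H| ^ n)%N.
  by rewrite cardsX cardsT card_ffun card_ord.
rewrite -(card_imset _ finj); apply: subset_leq_card.
apply/fintype.subsetP => _ /imsetP[[b w]] + ->.
rewrite !inE andbT /survives /hashx /hashy /= => hb.
by rewrite ![weigh _ _ + _]addrC !subrK eqxx.
Qed.

(** Distinct edges that share a coordinate differ in [x] or in [y]. Joint survival equates the
    weighed values of a coordinate in which they differ, which costs a factor [#|H|]; after that the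
    offsets are determined by the weights and the common hash value in [B]. *)
Lemma card_survives2 t e : t \in E -> e \in E -> e != t ->
  [|| agree x t e, agree y t e | agree z t e] ->
  (#|[set o | survives o t && survives o e]| * #|H| <= #|B| * #|H| ^ n)%N.
Proof.
move=> ht he et share.
have xy_dec (f : U -> 'I_n -> nat) : (forall e i, (f e i <= 4)%N) -> ~~ agree f t e ->
    (forall o, survives o t && survives o e -> weigh o.1 (f t) = weigh o.1 (f e)) ->
    (#|[set o | survives o t && survives o e]| * #|H| <= #|B| * #|H| ^ n)%N.
  move=> f4 /forallPn[j fj] hf.
  pose W := [set w | weigh w (f t) == weigh w (f e)].
  pose g (o : hash) := (hashx o t, o.1).
  apply: (@leq_trans (#|B| * #|W| * #|H|)); last first.
    by rewrite -mulnA leq_mul2l (card_weigh_eq (j := j)) ?orbT.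
  rewrite leq_mul2r -cardsX; apply/orP; right.
  rewrite -(@card_in_imset _ _ g).
    apply: subset_leq_card; apply/fintype.subsetP => _ /imsetP[ o so ->]; move: so.
    rewrite !inE => so; rewrite /= (hf _ so) eqxx andbT.
    by case/andP: so => /andP[].
  move=> [w [p1 p2]] [w' [p1' p2']]; rewrite !inE => so so' [].
  case/andP: so => /andP[/eqP + _] _; case/andP: so' => /andP[/eqP + _] _.
  rewrite /hashx /hashy /= => h1 h2 h3 ew; subst w'.
  by move: h1 h2; rewrite -h3 => -> /addrI->; move: h3 => /addrI->.
have hx o : agree y t e \/ agree z t e -> survives o t && survives o e ->
    weigh o.1 (x t) = weigh o.1 (x e).
  move=> sh /andP[/andP[/eqP st bt] /andP[/eqP se be]].
  suff : hashx o t = hashx o e by rewrite /hashx => /addIr.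
  case: sh => /agreeP sh.
    by rewrite st se /hashy; congr (_ + _); apply: eq_bigr => i _; rewrite sh.
  have := hash_add o ht he sh; rewrite -st -se => s2.
  apply/eqP; rewrite -subr_eq0; apply/eqP/(@torsion_free _ 2) => //.
  by rewrite mulr2n addrACA -opprD s2 subrr.
case/or3P: share => sh.
- apply: (xy_dec y) => //.
    apply: contraNN et => sh'; apply/eqP/esym/xy_inj => //; exact: (agreeP _ _ _ _).
  move=> o /andP[/andP[/eqP st _] /andP[/eqP se _]].
  suff : hashy o t = hashy o e by rewrite /hashy => /addIr.
  rewrite -st -se /hashx; congr (_ + _); apply: eq_bigr => i _.
  by move/agreeP: sh => ->.
- apply: (xy_dec x) => //.
    apply: contraNN et => sh'; apply/eqP/esym/xy_inj => //; exact: (agreeP _ _ _ _).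
  by move=> o; apply: hx; left.
- apply: (xy_dec x) => //.
    apply: contraNN et => sh'; apply/eqP/esym/xy_inj => //; first exact: (agreeP _ _ _ sh').
    move=> i; move/agreeP: sh' => /(_ i) sx; move/agreeP: sh => sz.
    by have := agree_z ht he sz i; lia.
  by move=> o; apply: hx; right.
Qed.

Let conflict t e := [&& e \in E, e != t & [|| agree x t e, agree y t e | agree z t e]].
Let matching o : {set U} :=
  [set t in T | survives o t & [forall e, conflict t e ==> ~~ survives o e]].

Lemma card_conflict t : t \in T -> (#|[set e | conflict t e]| <= 3 * D)%N.
Proof.
move=> tT; set X := [set e in E | agree x t e]; set Y := [set e in E | agree y t e].
set Z := [set e in E | agree z t e].
apply: (@leq_trans #|X :|: Y :|: Z|%SET).
  apply: subset_leq_card; apply/fintype.subsetP => e; rewrite !inE.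
  by case/and3P => -> _ /or3P[] -> //; rewrite ?orbT.
have hX : (#|X| <= D)%N := degx tT; have hY : (#|Y| <= D)%N := degy tT.
have hZ : (#|Z| <= D)%N := degz tT.
have h1 := (leq_card_setU X Y).1; have h2 := (leq_card_setU (X :|: Y) Z)%SET.1.
lia.
Qed.

(** Each survivor outside the matching is charged to one of its surviving conflicts. *)
Lemma card_survivors_le o :
  (\sum_(t in T) survives o t <= #|matching o| +
   \sum_(t in T) \sum_(e | conflict t e) (survives o t && survives o e))%N.
Proof.
rewrite -sum1_card big_mkcond [X in (X <= _)%N]big_mkcond.
rewrite [X in (_ <= _ + X)%N]big_mkcond [X in (_ <= X + _)%N]big_mkcond /=.
rewrite -big_split /=; apply: leq_sum => t _; rewrite !inE.
case: (t \in T) => //=; case st : (survives o t) => //=.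
case: ifPn => //; rewrite negb_forall => /existsP[e].
rewrite negb_imply negbK => /andP[ce se].
by rewrite (bigD1 e) //= se.
Qed.

(** Average over all hashes. As [6 * D <= #|H|], the conflicting pairs remove at most half of the
    expected number of survivors. *)
Lemma exists_matching : exists o, (#|T| * #|B| <= 2 * #|H| ^ 2 * #|matching o|)%N.
Proof.
pose N := (#|H| ^ n)%N.
have H0 : (0 < #|H|)%N by apply/card_gt0P; exists 0.
have N0 : (0 < N)%N by rewrite expn_gt0 H0.
have cardo : #|{: hash}| = (N * (#|H| * #|H|))%N by rewrite !card_prod card_ffun card_ord.
have low : (#|T| * (#|B| * N) <= \sum_(o : hash) \sum_(t in T) survives o t)%N.
  rewrite exchange_big /= -sum_nat_const; apply: leq_sum => t _.
  apply: leq_trans (card_survives t) _.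
  by rewrite -sum1_card [X in (X <= _)%N]big_mkcond; apply: leq_sum => o _; rewrite inE; case: ifP.
have up : ((\sum_(o : hash) \sum_(t in T) \sum_(e | conflict t e)
    (survives o t && survives o e)) * #|H| <= #|T| * (3 * D * (#|B| * N)))%N.
  rewrite exchange_big /= big_distrl /= -sum_nat_const; apply: leq_sum => t tT.
  rewrite exchange_big /= big_distrl /=.
  apply: (@leq_trans (\sum_(e | conflict t e) #|B| * N)%N).
    apply: leq_sum => e /and3P[eE et sh].
    apply: leq_trans (card_survives2 (fintype.subsetP TE _ tT) eE et sh).
    rewrite leq_mul2r -sum1_card [X in (_ <= X)%N]big_mkcond; apply/orP; right.
    by apply: leq_sum => o _; rewrite inE; case: ifP.
  rewrite sum_nat_const leq_mul2r; apply/orP; right.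
  by have := card_conflict tT; rewrite cardsE.
have split_le : (\sum_(o : hash) \sum_(t in T) survives o t <= \sum_(o : hash) (#|matching o| +
    \sum_(t in T) \sum_(e | conflict t e) (survives o t && survives o e)))%N.
  by apply: leq_sum => o _; exact: card_survivors_le.
rewrite big_split /= in split_le.
pose o0 : hash := (0, (0, 0)).
pose best := [arg max_(i > o0) #|matching i|]%N.
have best_max o : (#|matching o| <= #|matching best|)%N.
  by rewrite /best; case: arg_maxnP => // i _; apply.
exists best.
have sumM : (\sum_(o : hash) #|matching o| <= N * (#|H| * #|H|) * #|matching best|)%N.
  by rewrite -cardo -sum_nat_const; apply: leq_sum => o _.
set SS := (\sum_(o : hash) \sum_(t in T) survives o t)%N in low split_le.
set SM := (\sum_(o : hash) #|matching o|)%N in split_le sumM.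
set SC := (\sum_(o : hash) \sum_(t in T) \sum_(e | _) _)%N in split_le up.
have {}up : (2 * SC <= #|T| * (#|B| * N))%N.
  rewrite -(leq_pmul2r H0); have := leq_mul (leqnn (#|T| * (#|B| * N))) H_large.
  by nia.
rewrite -(leq_pmul2r N0).
by nia.
Qed.

(** If [e] agrees with [t1] in [x], [t2] in [y] and [t3] in [z], their hash values in [B] satisfy
    [b1 + b2 = b3 + b3], hence [b1 = b2]. Thus [e] survives too, and the absence of surviving
    conflicts identifies it with all three. *)
Lemma induced_matching : exists S : {set U},
  [/\ S \subset T, (#|T| * #|B| <= 2 * #|H| ^ 2 * #|S|)%N &
    forall t1 t2 t3 e, t1 \in S -> t2 \in S -> t3 \in S -> e \in E ->
      x e =1 x t1 -> y e =1 y t2 -> z e =1 z t3 -> t1 = t2 /\ t2 = t3].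
Proof.
have [ o card_o] := exists_matching.
exists (matching o); split => //.
  by apply/fintype.subsetP => t; rewrite inE => /andP[].
move=> t1 t2 t3 e; rewrite !inE => /and3P[T1 s1 c1] /and3P[T2 s2 c2] /and3P[T3 s3 c3] eE xe ye ze.
have hx : hashx o e = hashx o t1.
  by rewrite /hashx; congr (_ + _); apply: eq_bigr => i _; rewrite xe.
have hy : hashy o e = hashy o t2.
  by rewrite /hashy; congr (_ + _); apply: eq_bigr => i _; rewrite ye.
have hz := hash_add o eE (fintype.subsetP TE _ T3) ze.
case/andP: (s1) => /eqP s1e b1; case/andP: (s2) => /eqP s2e b2; case/andP: (s3) => /eqP s3e b3.
have b12 : hashx o t1 = hashx o t2.
  by apply: (B_progression_free b1 b2 b3); rewrite -hx s2e -hy hz -s3e.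
have se : survives o e by rewrite /survives hy hx b12 s2e eqxx /= -s2e.
have eq_e t : [forall e0, conflict t e0 ==> ~~ survives o e0] ->
    [|| agree x t e, agree y t e | agree z t e] -> e = t.
  move=> /forallP/(_ e) + sh; rewrite /conflict eE sh se andbT /= implybF negbK.
  by move=> /eqP.
have e1 : e = t1 by apply: eq_e => //; apply/or3P/Or31/agreeP => i; rewrite xe.
have e2 : e = t2 by apply: eq_e => //; apply/or3P/Or32/agreeP => i; rewrite ye.
have e3 : e = t3 by apply: eq_e => //; apply/or3P/Or33/agreeP => i; rewrite ze.
by rewrite -e1 -e2 -e3.
Qed.

End InducedMatching.

(** * The hash group and its progression-free subset *)

Lemma mulrn_Zp_eq0 (m k : nat) : (1 < m)%N -> coprime m 6 ->
  forall (v : 'rV['Z_m]_k) d, (0 < d <= 4)%N -> v *+ d = 0 -> v = 0.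
Proof.
move=> m1 m6 v d d4 vd; apply/rowP => i; rewrite mxE.
have : coprime m d.
  have [m2 m3] : coprime m 2 /\ coprime m 3.
    by apply/andP; rewrite -coprimeMr.
  have m4 : coprime m 4 by rewrite (coprimeMr m 2 2) m2.
  by case: d d4 {vd} => [|[|[|[|[|]]]]] //; rewrite coprimen1.
rewrite -unitZpE // => ud; apply: (mulIr ud); rewrite mul0r mulr_natr.
by have /rowP/(_ i) := vd; rewrite mulmxnE mxE.
Qed.

(* Behrend: among the vectors with digits at most [h], those of a fixed Euclidean
   norm lie on a sphere, and addition of two of them modulo [2 h + 1] does not wrap. *)
Lemma progression_free_set (h k : nat) : (0 < h)%N ->
  exists B : {set 'rV['Z_(2 * h).+1]_k},
    (h.+1 ^ k <= (k * h ^ 2).+1 * #|B|)%N /\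
    (forall a b d, a \in B -> b \in B -> d \in B -> a + b = d + d -> a = b).
Proof.
move=> h0; have m1 : (1 < (2 * h).+1)%N by lia.
pose V := {ffun 'I_k -> 'I_h.+1}.
pose emb (v : V) : 'rV['Z_(2 * h).+1]_k := \row_i (v i)%:R.
pose norm (v : V) := (\sum_i v i ^ 2)%N.
have norm_le v : (norm v < (k * h ^ 2).+1)%N.
  rewrite ltnS -[k in (k * _)%N]card_ord -sum_nat_const; apply: leq_sum => i _.
  by rewrite leq_exp2r // -ltnS.
have Zp_inj a b : (a <= 2 * h)%N -> (b <= 2 * h)%N ->
    (a%:R : 'Z_(2 * h).+1) = b%:R -> a = b.
  move=> ha hb /(congr1 val) /=.
  by rewrite !val_Zp_nat // !modn_small.
have emb_inj : injective emb.
  move=> u v /rowP e; apply/ffunP => i; apply/val_inj; have := e i; rewrite !mxE.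
  by apply: Zp_inj; have := ltn_ord (u i); have := ltn_ord (v i); lia.
pose layer (r : 'I_(k * h ^ 2).+1) := [set v : V | norm v == r].
(* Pigeonhole: the largest of the [k * h ^ 2 + 1] spheres. *)
pose best := [arg max_(r > (ord0 : 'I_(k * h ^ 2).+1)) #|layer r|]%N.
exists (emb @: layer best); split.
  rewrite card_imset // -[k in (_ ^ k)%N]card_ord -{1}(card_ord h.+1) -card_ffun.
  rewrite -[X in (_ <= X * _)%N]card_ord -sum_nat_const -[X in (X <= _)%N]sum1_card.
  rewrite (partition_big (fun v => Ordinal (norm_le v)) predT) //=.
  rewrite [X in (_ <= X)%N](eq_bigl predT) //. apply: leq_sum => r _.
  apply: (@leq_trans #|layer r|).
    by rewrite -sum1_card; apply: eq_leq; apply: eq_bigl => v; rewrite !inE -val_eqE.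
  by rewrite /best; case: arg_maxnP => // i _; apply.
move=> _ _ _ /imsetP[a + ->] /imsetP[b + ->] /imsetP[d + ->].
rewrite !inE => /eqP na /eqP nb /eqP nd e; congr emb.
have abd i : (a i + b i = d i + d i)%N.
  have /rowP/(_ i) := e; rewrite !mxE -!natrD; apply: Zp_inj.
    by rewrite mul2n -addnn leq_add // -ltnS.
  by rewrite mul2n -addnn leq_add // -ltnS.
(* The parallelogram law with [a + b = 2 d]. Subtraction is truncated, so at least one of the two
   squared differences vanishes and their sum is the true square. *)
have key : (\sum_i (2 * a i ^ 2 + 2 * b i ^ 2) =
    \sum_i (4 * d i ^ 2 + ((a i - b i) ^ 2 + (b i - a i) ^ 2)))%N.
  apply: eq_bigr => i _; have := abd i.
  move: (nat_of_ord (a i)) (nat_of_ord (b i)) (nat_of_ord (d i)) => p q r pqr.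
  case: (leqP p q) => [|/ltnW] /subnKC => pq; nia.
have scale q (v : V) : (\sum_i q * v i ^ 2 = q * norm v)%N by rewrite /norm big_distrr.
move: key; rewrite big_split /= [X in _ = X]big_split /= !scale na nb nd => key.
have /eqP : (\sum_i ((a i - b i) ^ 2 + (b i - a i) ^ 2) = 0)%N.
  by apply: (@addnI (4 * best)%N); rewrite addn0 -key -mulnDl.
rewrite sum_nat_eq0 => /forallP dist0.
apply/ffunP => i; apply/val_inj; have /= := dist0 i.
rewrite addn_eq0 !expn_eq0 /= !andbT !subn_eq0 => /andP[ab ba].
by apply/eqP; rewrite eqn_leq ab ba.
Qed.

(** * Sequences of a given type *)

Section Multinomial.
Variables (K Sym : finType) (cl : Sym -> K).
Local Open Scope nat_scope.

Definition has_type (ks : seq K) (k : Sym -> nat) (t : seq Sym) :=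
  (map cl t == ks) && [forall s, count_mem s t == k s].

Lemma sum_tuple_cons n (F : n.+1.-tuple Sym -> nat) :
  \sum_t F t = \sum_s \sum_(t : n.-tuple Sym) F [tuple of s :: t].
Proof.
rewrite pair_big /= (reindex (fun p : Sym * n.-tuple Sym => [tuple of p.1 :: p.2])) //=.
exists (fun t => (thead t, [tuple of behead t])) => [[s t] _|t _] /=.
  by congr (_, _); apply/val_inj.
by rewrite -tuple_eta.
Qed.

Definition dec (k : Sym -> nat) s : Sym -> nat := fun s' => k s' - (s' == s).

Lemma has_type_cons c ks k s t :
  has_type (c :: ks) k (s :: t) = [&& cl s == c, 0 < k s & has_type ks (dec k s) t].
Proof.
rewrite /has_type /= eqseq_cons; case: (cl s == c) => //=.
case: (map cl t == ks) => /=; last by rewrite andbF.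
apply/forallP/andP => [h|[ks0 /forallP h] s'].
  split; first by have /eqP <- := h s; rewrite eqxx.
  apply/forallP => s'; rewrite /dec; have /eqP <- := h s'.
  by rewrite [s == s']eq_sym addKn.
have /eqP -> := h s'; rewrite /dec [s == s']eq_sym subnKC //.
by case: (s' =P s) => [->|].
Qed.

Lemma prod_fact_dec k s : 0 < k s -> \prod_s' (k s')`! = k s * \prod_s' (dec k s s')`!.
Proof.
move=> ks0; rewrite (bigD1 s) //= [in RHS](bigD1 s) //= mulnA; congr (_ * _).
  by rewrite /dec eqxx subn1 -[in LHS](prednK ks0) factS prednK.
by apply: eq_bigr => s' /negPf ne; rewrite /dec ne subn0.
Qed.

(** A product of multinomial coefficients, one per class, stated without division. In the induction
    a first symbol [s] contributes a factor [k s], and these factors add up to the number of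
    occurrences of the first class. *)
Lemma card_has_type n (ks : seq K) (k : Sym -> nat) : size ks = n ->
  (forall c, count_mem c ks = \sum_(s | cl s == c) k s) ->
  (\sum_(t : n.-tuple Sym) has_type ks k t) * \prod_s (k s)`! = \prod_c (count_mem c ks)`!.
Proof.
elim: n ks k => [|n IH] [|c ks] k //= => [_|[sz]] cnt.
  have k0 s : k s = 0.
    by have /esym/eqP := cnt (cl s); rewrite sum_nat_eq0 => /forallP/(_ s); rewrite eqxx => /eqP.
  rewrite (big1 _ _ (fun c => (count_mem c [::])`!)) //.
  rewrite (big1 _ _ (fun s => (k s)`!)) ?muln1 => [|s _]; last by rewrite k0.
  rewrite (eq_bigr (fun=> 1)) ?sum1_card ?card_tuple ?expn0 // => t _.
  rewrite (tuple0 t) /has_type /= ?eqxx /=; apply/eqP; rewrite eqb1.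
  by apply/forallP => s; rewrite k0.
rewrite sum_tuple_cons big_distrl /=.
transitivity (\sum_(s | cl s == c) k s * \prod_c' (count_mem c' ks)`!).
  rewrite [RHS]big_mkcond; apply: eq_bigr => s _.
  under eq_bigr => t _ do rewrite has_type_cons.
  case: eqP => [es|_] /=; last by rewrite big1 ?mul0n.
  case: (posnP (k s)) => [-> /=|ks0]; first by rewrite big1 ?mul0n.
  rewrite (prod_fact_dec ks0) mulnCA -(IH ks (dec k s)) // => c'.
  apply: (@addnI (c == c')); rewrite cnt.
  have -> : (c == c') = \sum_(s' | cl s' == c') (s' == s) :> nat.
    rewrite -es; have [ec|nc] := eqVneq (cl s) c'.
      by rewrite (bigD1 s) ?ec //= eqxx big1 // => s' /andP[_ /negPf->].
    by rewrite big1 // => s' /eqP es'; case: eqP => // ess; rewrite -ess es' eqxx in nc.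
  rewrite -big_split /=; apply: eq_bigr => s' _; rewrite /dec subnKC //.
  by case: eqP => [->|].
rewrite -big_distrl /= -cnt (bigD1 c) //= [in RHS](bigD1 c) //= !eqxx mulnA.
congr (_ * _).
apply: eq_bigr => c' /negPf ne; by rewrite eq_sym ne.
Qed.

End Multinomial.

(** The upper half of a weak Stirling formula; the induction step is
    [e <= (1 + 1 / p) ^ (p + 1)]. *)
Lemma fact_le_expn (R : realType) (m : nat) : (0 < m)%N ->
  m`!%:R * expR 1 ^+ m <= expR 1 * m%:R * m%:R ^+ m :> R.
Proof.
elim: m => // -[|m] IH _; first by rewrite !expr1 mul1r !mulr1.
have {}IH := IH isT; set e := expR 1 in IH *; have e0 : 0 < e by exact: expR_gt0.
set p := m.+1 in IH *; have p0 : 0 < p%:R :> R by rewrite ltr0n.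
have step : p%:R * expR (p.+1%:R^-1) <= p.+1%:R :> R.
  have := expR_ge1Dx (- p.+1%:R^-1 : R).
  rewrite expRN => h.
  have q0 : 0 < p.+1%:R :> R by rewrite ltr0n.
  rewrite -ler_pdivlMr ?expR_gt0 //; apply: le_trans (ler_wpM2l (ltW q0) h).
  by rewrite mulrDr mulr1 mulrN divff ?gt_eqF // -natr1 addrK.
have {}step : p%:R ^+ p.+1 * e <= p.+1%:R ^+ p.+1 :> R.
  have -> : e = expR (p.+1%:R^-1) ^+ p.+1.
    by rewrite -expRM_natl divff // gt_eqF // ltr0n.
  by rewrite -exprMn lerXn2r // nnegrE ?mulr_ge0 ?expR_ge0.
rewrite factS natrM [e ^+ p.+1]exprS.
apply: (@le_trans _ _ (p.+1%:R * e * (e * p%:R * p%:R ^+ p))).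
  rewrite [leLHS](_ : _ = p.+1%:R * e * (p`!%:R * e ^+ p)); last by ring.
  by rewrite ler_wpM2l // mulr_ge0 // ltW.
rewrite [leLHS](_ : _ = p.+1%:R * e * (p%:R ^+ p.+1 * e)); last by rewrite exprS; ring.
by rewrite [e * _]mulrC ler_wpM2l // mulr_ge0 // ltW.
Qed.

Section TypeClass.
Variables (K Sym : finType) (cl : Sym -> K).
Local Open Scope nat_scope.

Definition class_size (k : Sym -> nat) c := \sum_(s | cl s == c) k s.

Definition type_class n (ka : {ffun 'I_n -> K}) (k : Sym -> nat) : {set {ffun 'I_n -> Sym}} :=
  [set t : {ffun 'I_n -> Sym} | [forall p, cl (t p) == ka p]
     && [forall s, #|[set p | t p == s]| == k s]].

Lemma count_mem_mktuple (T : finType) n (f : {ffun 'I_n -> T}) (c : T) :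
  count_mem c [tuple f i | i < n] = #|[set p | f p == c]|.
Proof.
rewrite /= count_map -sum1_count -sum1_card big_enum_cond /=.
by apply: eq_bigl => j; rewrite !inE.
Qed.

Lemma card_type_class n (ka : {ffun 'I_n -> K}) (k : Sym -> nat) :
  (forall c, #|[set p | ka p == c]| = class_size k c) ->
  #|type_class ka k| * \prod_s (k s)`! = \prod_c (class_size k c)`!.
Proof.
move=> cnt; pose ks := [tuple ka i | i < n].
have cnt' c : count_mem c ks = class_size k c by rewrite -cnt -count_mem_mktuple.
have := card_has_type (size_tuple ks) cnt'.
under [in RHS]eq_bigr => c _ do rewrite cnt'.
move=> <-; congr (_ * _).
rewrite (reindex (fun f : {ffun 'I_n -> Sym} => [tuple f i | i < n])) /=; last first.
  exists (fun t => [ffun i => tnth t i]) => [f _|t _].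
    by apply/ffunP => i; rewrite ffunE tnth_mktuple.
  by apply: eq_from_tnth => i; rewrite tnth_mktuple ffunE.
rewrite -sum1_card big_mkcond; apply: eq_bigr => f _.
rewrite inE /has_type.
have -> : [forall p, cl (f p) == ka p] = (map cl [tuple f i | i < n] == ks).
  apply/forallP/eqP => [h|h p].
    rewrite /= -map_comp; apply: eq_map => i /=; exact/eqP.
  have /(congr1 (fun t => tnth t p)) : map_tuple cl [tuple f i | i < n] = ks by exact/val_inj.
  by rewrite tnth_map !tnth_mktuple => ->.
rewrite (eq_forallb (P2 := fun s => count_mem s [tuple f i | i < n] == k s)) => [|s].
  by case: ifP.
by rewrite count_mem_mktuple.
Qed.

Local Open Scope ring_scope.

(** The entropy estimate for a type class, with a loss polynomial in [N]. The powers of [N] from the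
    two Stirling bounds cancel, because the class sizes and the symbol counts have the same
    total. *)
Lemma type_class_card_ge (R : realType) n N (ka : {ffun 'I_n -> K}) (k : Sym -> nat) :
  (0 < N)%N -> (forall s, 0 < k s)%N ->
  (forall c, #|[set p | ka p == c]| = N * class_size k c)%N ->
  (\prod_c (class_size k c)%:R ^+ class_size k c) ^+ N <=
  #|type_class ka (fun s => N * k s)%N|%:R * (\prod_s (k s)%:R ^+ k s) ^+ N
    * \prod_s (4 * (N * k s)%:R) :> R.
Proof.
move=> N0 k0 cnt.
pose Nk s := (N * k s)%N.
have csN c : class_size Nk c = (N * class_size k c)%N by rewrite /class_size big_distrr.
have cntN c : #|[set p | ka p == c]| = class_size Nk c by rewrite csN cnt.
have := card_type_class cntN; rewrite -/Nk.
under [in RHS]eq_bigr => c _ do rewrite csN.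
set T := #|_| => /(congr1 (fun m => m%:R : R)); rewrite natrM !natr_prod => eqT.
have tot : (\sum_c class_size k c = \sum_s k s)%N.
  by rewrite [RHS](partition_big cl predT).
have splitN (J : finType) (a : J -> nat) :
    \prod_j (N * a j)%:R ^+ (N * a j) =
    N%:R ^+ (N * \sum_j a j) * (\prod_j (a j)%:R ^+ a j) ^+ N :> R.
  rewrite big_distrr /= expr_sum -prodrXl -big_split /=; apply: eq_bigr => j _.
  by rewrite natrM exprMn -exprM [(a j * N)%N]mulnC.
set e : R := expR 1; have e0 : 0 < e by exact: expR_gt0.
have low : \prod_c (N * class_size k c)%:R ^+ (N * class_size k c) <=
    \prod_c (N * class_size k c)`!%:R * e ^+ (N * \sum_s k s) :> R.
  rewrite -tot big_distrr /= expr_sum -big_split /=; apply: ler_prod => c _.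
  by rewrite exprn_ge0 //= expn_le_fact.
have up : \prod_s (N * k s)`!%:R * e ^+ (N * \sum_s k s) <=
    \prod_s (4 * (N * k s)%:R) * \prod_s (N * k s)%:R ^+ (N * k s) :> R.
  rewrite big_distrr /= expr_sum -!big_split /=; apply: ler_prod => s _.
  apply/andP; split; first by rewrite mulr_ge0 // exprn_ge0 // ltW.
  apply: le_trans (fact_le_expn R _) _; first by rewrite muln_gt0 N0 k0.
  by rewrite ler_wpM2r ?exprn_ge0 // ler_wpM2r // expR1_le4.
have NN : 0 < N%:R ^+ (N * \sum_s k s) :> R by rewrite exprn_gt0 // ltr0n.
rewrite -(ler_pM2l NN) -{1}tot -splitN; apply: (le_trans low).
rewrite -eqT -mulrA; apply: le_trans (ler_wpM2l _ up) _ => //.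
rewrite splitN; set P := \prod_s (4 * _); set Q := (\prod_s _) ^+ N.
by rewrite [leLHS](_ : _ = N%:R ^+ (N * \sum_s k s) * (T%:R * Q * P)) //; ring.
Qed.

End TypeClass.

(** * Extraction of an induced matching from a type *)

Section Laser.
Variables (R : realType) (K Sym : finType) (cl : Sym -> K) (x y z : Sym -> nat).
Variables (c : K -> nat) (k : Sym -> nat) (f g h : K -> nat -> nat).
Hypothesis k_gt0 : forall s, (0 < k s)%N.
Hypothesis xyz_sum : forall s, (x s + y s + z s = c (cl s))%N.
Hypothesis x_le4 : forall s, (x s <= 4)%N.
Hypothesis y_le4 : forall s, (y s <= 4)%N.
Hypothesis xy_inj : forall s s', cl s = cl s' -> x s = x s' -> y s = y s' -> s = s'.
(* The product form makes the distribution [k] the one of maximal entropy for its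
   three marginals. *)
Hypothesis k_prod : forall s, (k s = f (cl s) (x s) * g (cl s) (y s) * h (cl s) (z s))%N.

Definition fiber_weight (l : Sym -> nat) s := (\sum_(s' | (cl s' == cl s) && (l s' == l s)) k s')%N.

Definition type_weight : R := \prod_s (k s)%:R ^+ k s.
Definition class_weight : R := \prod_a (class_size cl k a)%:R ^+ class_size cl k a.

Variable A : R.
Hypothesis Ax : \prod_s (fiber_weight x s)%:R ^+ k s <= A.
Hypothesis Ay : \prod_s (fiber_weight y s)%:R ^+ k s <= A.
Hypothesis Az : \prod_s (fiber_weight z s)%:R ^+ k s <= A.

Lemma type_weight_ge1 : 1 <= type_weight.
Proof.
rewrite /type_weight (eq_bigr (fun s => (k s ^ k s)%:R)) => [|s _]; last by rewrite natrX.
by rewrite -natr_prod ler1n prodn_gt0 // => s; rewrite expn_gt0 k_gt0.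
Qed.

Lemma type_weight_le : type_weight <= A.
Proof.
apply: le_trans Ax; apply: ler_prod => s _; rewrite exprn_ge0 //=.
by rewrite lerXn2r // ?nnegrE // ler_nat /fiber_weight (bigD1 s) ?eqxx // leq_addr.
Qed.

Section FixedLength.
Variables (n N : nat) (ka : {ffun 'I_n -> K}).
Hypothesis N_gt0 : (0 < N)%N.
Hypothesis ka_size : forall a, (#|[set p | ka p == a]| = N * class_size cl k a)%N.

Let T := type_class cl ka (fun s => N * k s)%N.
Let word := {ffun 'I_n -> Sym}.
Definition along (l : Sym -> nat) (e : word) p := l (e p).

(** The edges of the hypergraph to be thinned out: the three level patterns may come from three
    different words of [T]. *)
Definition mixed : {set word} :=
  [set e : word | [forall p, cl (e p) == ka p] &&
    [exists t1 in T, exists t2 in T, exists t3 in T,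
      [&& agree (along x) e t1, agree (along y) e t2 & agree (along z) e t3]]].

Lemma in_type_class t : t \in T -> forall p, cl (t p) = ka p.
Proof. by rewrite inE => /andP[/forallP ht _] p; apply/eqP. Qed.

Lemma type_class_prod t (F : Sym -> R) : t \in T ->
  \prod_p F (t p) = (\prod_s F s ^+ k s) ^+ N.
Proof.
rewrite inE => /andP[_ /forallP hk].
rewrite (partition_big t predT) //= -prodrXl; apply: eq_bigr => s _.
rewrite -exprM mulnC -(eqP (hk s)) -prodr_const.
by apply: eq_big => [p|p /eqP-> //]; rewrite !inE.
Qed.

Lemma sub_mixed : T \subset mixed.
Proof.
apply/fintype.subsetP => t tT; rewrite inE; apply/andP; split.
  by apply/forallP => p; rewrite in_type_class.
have ag l : agree (along l) t t by apply/agreeP.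
by do 3 ![apply/existsP; exists t; rewrite tT /=]; rewrite !ag.
Qed.

(** By [k_prod] the product splits into three factors, each a function of one level pattern. Each
    factor therefore has the value that it takes on words of [T]. *)
Lemma mixed_prod e : e \in mixed -> \prod_p (k (e p))%:R = type_weight ^+ N.
Proof.
rewrite inE => /andP[/forallP he /existsP[t1 /andP[T1 /existsP[t2 /andP[T2
  /existsP[t3 /andP[T3 /and3P[/agreeP e1 /agreeP e2 /agreeP e3]]]]]]]].
have step (l : Sym -> nat) (F : K -> nat -> nat) t : t \in T -> along l e =1 along l t ->
    \prod_p (F (cl (e p)) (l (e p)))%:R = (\prod_s (F (cl s) (l s))%:R ^+ k s) ^+ N :> R.
  move=> tT el; rewrite -(type_class_prod _ tT); apply: eq_bigr => p _.
  by rewrite (eqP (he p)) -(in_type_class tT p) (el p : l (e p) = l (t p)).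
under eq_bigr => p _ do rewrite k_prod !natrM.
rewrite !big_split /= (step x f t1) // (step y g t2) // (step z h t3) // -!exprMn.
congr (_ ^+ _); rewrite /type_weight -!big_split; apply: eq_bigr => s _.
by rewrite /= -!exprMn -!natrM -k_prod.
Qed.

(** Weigh a word by the product of [k] along it. The words with the classes and the [l]-pattern of
    [t] have total weight [\prod_p fiber_weight l (t p)], and every mixed word among them weighs
    [type_weight ^+ N]. *)
Lemma mixed_degree (l : Sym -> nat) t : \prod_s (fiber_weight l s)%:R ^+ k s <= A -> t \in T ->
  #|[set e in mixed | agree (along l) t e]|%:R * type_weight ^+ N <= A ^+ N.
Proof.
move=> Al tT; set X := [set e in mixed | _].
have -> : #|X|%:R * type_weight ^+ N = \sum_(e in X) \prod_p (k (e p))%:R.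
  rewrite (eq_bigr (fun=> type_weight ^+ N)) ?sumr_const ?mulr_natl // => e.
  by rewrite inE => /andP[/mixed_prod].
pose Q p := [pred s | (cl s == cl (t p)) && (l s == l (t p))].
apply: (@le_trans _ _ (\sum_(e in family Q) \prod_p (k (e p))%:R)).
  rewrite [leLHS]big_mkcond [leRHS]big_mkcond /=; apply: ler_sum => e _.
  have p0 : 0 <= \prod_p (k (e p))%:R :> R by exact: prodr_ge0.
  case: ifP => [|_]; last by case: ifP.
  rewrite inE => /andP[+ /agreeP et]; rewrite inE => /andP[/forallP he _].
  rewrite ifT //; apply/familyP => p; rewrite inE (in_type_class tT) he /=.
  by apply/eqP; exact: (esym (et p)).
rewrite -(bigA_distr_big_dep Q (fun _ s => (k s)%:R)).
rewrite (eq_bigr (fun p => (fiber_weight l (t p))%:R)) => [|p _]; last first.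
  by rewrite -natr_sum.
rewrite (type_class_prod (fun s => (fiber_weight l s)%:R) tT).
have A0 : 0 <= A by apply: le_trans Al; apply: prodr_ge0 => s _; rewrite exprn_ge0.
by rewrite lerXn2r // nnegrE // prodr_ge0 // => s _; rewrite exprn_ge0.
Qed.

Variable d : nat.
Hypothesis d_gt0 : (0 < d)%N.
Let m := (2 * d).+1.
Hypothesis m_coprime : coprime m 6.

Definition matched (S : {set word}) := forall t1 t2 t3 e : word,
  t1 \in S -> t2 \in S -> t3 \in S -> (forall p, cl (e p) = ka p) ->
  (forall p, x (e p) = x (t1 p)) -> (forall p, y (e p) = y (t2 p)) ->
  (forall p, z (e p) = z (t3 p)) -> t1 = t2 /\ t2 = t3.

Let P : R := \prod_s (4 * (N * k s)%:R).

(** The hash group [(Z/m)^q] has to exceed six times the degree [(A / type_weight) ^ N]. Choosing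
    [q] least keeps its order within a factor [m] of this threshold. *)
Lemma laser_finite : exists (S : {set word}) (q : nat),
  [/\ S \subset T, matched S,
      class_weight ^+ N <= A ^+ N * #|S|%:R * (12 * m%:R * (P * (2 ^+ q * (q * d ^ 2).+1%:R)))
    & m%:R ^+ q <= 6 * m%:R * A ^+ N].
Proof.
have tw0 : 0 < type_weight by apply: lt_le_trans type_weight_ge1.
have A1 : 1 <= A by apply: le_trans type_weight_le; exact: type_weight_ge1.
have A0 : 0 <= A := le_trans ler01 A1.
have twN : 0 < type_weight ^+ N by rewrite exprn_gt0.
have m1 : (1 < m)%N by rewrite /m; lia.
have ex_q : exists q, 6 * A ^+ N <= m%:R ^+ q * type_weight ^+ N.
  have b0 : 0 <= 6 * A ^+ N by rewrite mulr_ge0 // exprn_ge0 // (le_trans _ A1).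
  exists (Num.bound (6 * A ^+ N)); apply: le_trans (ltW (archi_boundP b0)) _.
  apply: (@le_trans _ _ (m%:R ^+ Num.bound (6 * A ^+ N))).
    by rewrite -natrX ler_nat ltnW // ltn_expl.
  by rewrite ler_peMr ?exprn_ge0 // exprn_ege1 // type_weight_ge1.
pose q := ex_minn ex_q.
have q_large : 6 * A ^+ N <= m%:R ^+ q * type_weight ^+ N by rewrite /q; case: ex_minnP.
have q_small : m%:R ^+ q * type_weight ^+ N <= 6 * m%:R * A ^+ N.
  have mR1 : 1 <= m%:R :> R by rewrite ler1n.
  rewrite /q; case: ex_minnP => -[|q'] _ qmin.
    rewrite expr0 mul1r; apply: (@le_trans _ _ (A ^+ N)).
      by apply: lerXn2r; rewrite ?nnegrE ?(ltW tw0) ?A0 // type_weight_le.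
    by rewrite ler_peMl ?exprn_ge0 //; lra.
  have : ~~ (6 * A ^+ N <= m%:R ^+ q' * type_weight ^+ N).
    by apply/negP => /qmin; rewrite ltnn.
  rewrite -ltNge => /ltW hq; rewrite exprS -mulrA -[6 * _]mulrC -[leRHS]mulrA.
  by rewrite ler_wpM2l.
have [B [cardB freeB]] := progression_free_set q d_gt0.
have tors := @mulrn_Zp_eq0 m q m1 m_coprime.
have cardH : #|{: 'rV['Z_m]_q}| = (m ^ q)%N by rewrite card_mx card_ord mul1n Zp_cast.
pose D := (m ^ q %/ 6)%N.
have degD l t : \prod_s (fiber_weight l s)%:R ^+ k s <= A -> t \in T ->
    (#|[set e in mixed | agree (along l) t e]| <= D)%N.
  move=> Al tT; rewrite leq_divRL // -(ler_nat R) natrM natrX -(ler_pM2r twN).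
  apply: le_trans q_large; have := mixed_degree Al tT.
  by set u := _%:R * _ => hu; rewrite mulrAC -/u mulrC ler_wpM2l.
have [S [ST cardS S_ind]] : exists S : {set word},
  [/\ S \subset T, (#|T| * #|B| <= 2 * #|{: 'rV['Z_m]_q}| ^ 2 * #|S|)%N &
    forall t1 t2 t3 e, t1 \in S -> t2 \in S -> t3 \in S -> e \in mixed ->
      along x e =1 along x t1 -> along y e =1 along y t2 -> along z e =1 along z t3 ->
      t1 = t2 /\ t2 = t3].
  apply: (@induced_matching _ n tors _ mixed T (along x) (along y) (along z)
    (fun p => c (ka p)) B D sub_mixed) => //.
  - by move=> e p; exact: x_le4.
  - by move=> e p; exact: y_le4.
  - by move=> e p; rewrite inE => /andP[/forallP/(_ p)/eqP <- _]; exact: xyz_sum.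
  - move=> e e'; rewrite !inE => /andP[/forallP he _] /andP[/forallP he' _] ex ey.
    apply/ffunP => p; apply: xy_inj; [|exact: (ex p)|exact: (ey p)].
    by rewrite (eqP (he p)) (eqP (he' p)).
  - by move=> t; exact: degD.
  - by move=> t; exact: degD.
  - by move=> t; exact: degD.
  - by rewrite cardH mulnC leq_divM.
exists S, q; split => //.
- move=> t1 t2 t3 e S1 S2 S3 he ex ey ez; apply: (S_ind t1 t2 t3 e) => //.
  rewrite inE; apply/andP; split; first by apply/forallP => p; rewrite he.
  apply/existsP; exists t1; rewrite (fintype.subsetP ST _ S1) /=.
  apply/existsP; exists t2; rewrite (fintype.subsetP ST _ S2) /=.
  apply/existsP; exists t3; rewrite (fintype.subsetP ST _ S3) /=.
  by apply/and3P; split; apply/agreeP.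
- rewrite cardH in cardS.
  have i1 := type_class_card_ge R N_gt0 k_gt0 ka_size.
  rewrite -/T -/P -/type_weight -/class_weight in i1.
  have i2 : #|T|%:R * #|B|%:R <= 2 * (m%:R ^+ q) ^+ 2 * #|S|%:R :> R.
    by rewrite -!natrX -!natrM ler_nat.
  have i3 : d.+1%:R ^+ q <= (q * d ^ 2).+1%:R * #|B|%:R :> R.
    by rewrite -natrX -natrM ler_nat.
  (* Restricting to digits at most [d] costs less than a factor 2 per coordinate. *)
  have i5 : m%:R ^+ q <= 2 ^+ q * d.+1%:R ^+ q :> R.
    rewrite -exprMn -natrM; apply: lerXn2r; rewrite ?nnegrE ?ler0n // ler_nat.
    by rewrite /m mulnS -add1n leq_add2r.
  have M0 : 0 < m%:R ^+ q :> R by rewrite exprn_gt0 // ltr0n.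
  have P0 : 0 <= P by apply: prodr_ge0 => s _; rewrite mulr_ge0.
  move: i1 i2 i3 i5 M0 q_small twN P0.
  set cw := class_weight ^+ N; set w := type_weight ^+ N; set Mq := m%:R ^+ q.
  set tt := #|T|%:R; set b := #|B|%:R; set ss := #|S|%:R; set u := (q * d ^ 2).+1%:R.
  set v := d.+1%:R ^+ q; set a := A ^+ N; set r := 2 ^+ q.
  move=> i1 i2 i3 i5 M0 q_small w0 P0.
  have r0 : 0 <= r by rewrite exprn_ge0.
  have tt0 : 0 <= tt by [].
  have ss0 : 0 <= ss by [].
  have u0 : 0 <= u by [].
  rewrite -(ler_pM2l M0).
  apply: (@le_trans _ _ (r * v * (tt * w * P))).
    apply: ler_pM => //; first exact: ltW.
    by rewrite exprn_ge0 // prodr_ge0 // => a0 _; rewrite exprn_ge0.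
  apply: (@le_trans _ _ (r * (u * b) * (tt * w * P))).
    apply: ler_wpM2r; first by rewrite !mulr_ge0 // ltW.
    by apply: ler_wpM2l.
  rewrite [leLHS](_ : _ = r * u * w * P * (tt * b)); last by ring.
  apply: (@le_trans _ _ (r * u * w * P * (2 * Mq ^+ 2 * ss))).
    by apply: ler_wpM2l => //; rewrite !mulr_ge0 // ltW.
  rewrite [leLHS](_ : _ = Mq * (2 * r * u * P * ss) * (Mq * w)); last by ring.
  rewrite [leRHS](_ : _ = Mq * (2 * r * u * P * ss) * (6 * m%:R * a)); last by ring.
  by apply: ler_wpM2l => //; rewrite !mulr_ge0 // ltW.
- apply: le_trans q_small; rewrite ler_peMr ?exprn_ge0 //.
  by rewrite exprn_ege1 // type_weight_ge1.
Qed.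

End FixedLength.
End Laser.

(** * Absorbing the subexponential losses *)

Lemma poly_le_exp (R : realType) (C phi : R) (d : nat) : 0 <= C -> 1 < phi ->
  exists N0, forall N, (N0 <= N)%N -> C * N.+1%:R ^+ d <= phi ^+ N.
Proof.
move=> C0 phi1; have L0 : 0 < ln phi by exact: ln_gt0.
set L := ln phi in L0.
pose b := C * 2 ^+ d * d.+1`!%:R / L ^+ d.+1.
have b0 : 0 <= b by rewrite divr_ge0 ?mulr_ge0 ?exprn_ge0 // ltW.
exists (Num.bound b).+1 => N hN.
have bN : b <= N%:R.
  by apply: le_trans (ltW (archi_boundP b0)) _; rewrite ler_nat ltnW.
have phi0 : 0 < phi by exact: lt_trans phi1.
have -> : phi ^+ N = expR (N%:R * L) by rewrite expRM_natl lnK.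
have NL0 : 0 <= N%:R * L by rewrite mulr_ge0 // ltW.
apply: le_trans (_ : (N%:R * L) ^+ d.+1 / d.+1`!%:R <= _); last first.
  by apply: le_trans (expR_ge1Dxn d NL0); rewrite lerDr.
apply: (@le_trans _ _ (C * (2 * N%:R) ^+ d)).
  rewrite ler_wpM2l // lerXn2r ?nnegrE ?mulr_ge0 // -natrM ler_nat; lia.
rewrite ler_pdivlMr ?ltr0n ?fact_gt0 // !exprMn exprS.
rewrite [leLHS](_ : _ = b * (N%:R ^+ d * L ^+ d.+1)); last first.
  by rewrite /b; field; rewrite gt_eqF // exprn_gt0.
rewrite -[leRHS]mulrA ler_wpM2r // mulr_ge0 ?exprn_ge0 // ltW //.
Qed.

Lemma exp_unbounded (R : realType) (C phi : R) : 0 <= C -> 1 < phi ->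
  exists2 j, (0 < j)%N & C <= phi ^+ j.
Proof.
move=> C0 phi1; have [N0 /(_ N0.+1)] := poly_le_exp 0 C0 phi1.
by rewrite expr0 mulr1 => /(_ (leqnSn _)) h; exists N0.+1.
Qed.

(* [theta] absorbs the subexponential losses, both in the size of the type class and in
   the density of the progression-free set. *)
Lemma laser (R : realType) (K Sym : finType) (cl : Sym -> K) (x y z : Sym -> nat)
    (c : K -> nat) (k : Sym -> nat) (f g h : K -> nat -> nat) (A theta : R) :
  (forall s, (0 < k s)%N) ->
  (forall s, (x s + y s + z s = c (cl s))%N) ->
  (forall s, (x s <= 4)%N) -> (forall s, (y s <= 4)%N) ->
  (forall s s', cl s = cl s' -> x s = x s' -> y s = y s' -> s = s') ->
  (forall s, (k s = f (cl s) (x s) * g (cl s) (y s) * h (cl s) (z s))%N) ->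
  \prod_s (fiber_weight cl k x s)%:R ^+ k s <= A ->
  \prod_s (fiber_weight cl k y s)%:R ^+ k s <= A ->
  \prod_s (fiber_weight cl k z s)%:R ^+ k s <= A ->
  1 < theta ->
  exists N0, forall N, (N0 <= N)%N -> (0 < N)%N -> forall n (ka : {ffun 'I_n -> K}),
    (forall a, (#|[set p | ka p == a]| = N * class_size cl k a)%N) ->
    exists S : {set {ffun 'I_n -> Sym}},
      [/\ S \subset type_class cl ka (fun s => N * k s)%N, matched cl x y z ka S
        & class_weight R cl k ^+ N <= A ^+ N * #|S|%:R * theta ^+ N].
Proof.
move=> k0 xyz x4 y4 inj kp Ax Ay Az th1.
have A1 : 1 <= A.
  exact: le_trans (type_weight_ge1 R k0) (type_weight_le Ax).
have A0 : 0 <= A := le_trans ler01 A1.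
have [j j0 hj] := exp_unbounded (exprn_ge0 2 A0) th1.
(* Thus [m = 6 * 2 ^ J + 1] is coprime to 6. As [m >= 2 ^ J] and [A ^ 2 <= theta ^ j], the density
   loss [(2 ^ q) ^ 2] is at most a constant times [theta ^ (N / 2)]; the other half of the exponent
   absorbs the polynomial. *)
pose J := (2 * j)%N; pose d := (3 * 2 ^ J)%N; pose m := (2 * d).+1.
have d0 : (0 < d)%N by rewrite muln_gt0 expn_gt0.
have m6 : coprime m 6.
  have -> : m = (2 ^ J * 6 + 1)%N by rewrite /m /d mulnA mulnC addn1.
  by rewrite -coprime_modl modnMDl.
have m2 : (2 ^ J <= m)%N by rewrite /m /d mulnA; apply: leqW; exact: leq_pmull.
pose E := #|Sym|; pose C1 : R := \prod_s (4 * (k s)%:R).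
have C10 : 0 <= C1 by apply: prodr_ge0 => s _; rewrite mulr_ge0.
pose C2 : R := 12 * m%:R * (d ^ 2).+1%:R * C1.
have C20 : 0 <= C2 by rewrite !mulr_ge0.
have C30 : 0 <= C2 ^+ (2 * j) * (6 * m%:R) ^+ 2.
  by rewrite mulr_ge0 // exprn_ge0 // mulr_ge0.
have thj : 1 < theta ^+ j by rewrite exprn_egt1 // -lt0n.
have [N0 hN0] := poly_le_exp (E * (2 * j)) C30 thj.
exists N0 => N hN N_gt0 n ka ka_size.
have [S [q [ST mS cS qS]]] := laser_finite k0 xyz x4 y4 inj kp Ax Ay Az N_gt0 ka_size d0 m6.
exists S; split => //; apply: (le_trans cS); apply: ler_wpM2l.
  by rewrite mulr_ge0 // exprn_ge0.
set P := \prod_s _.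
have P_ge0 : 0 <= P by apply: prodr_ge0 => s _; rewrite mulr_ge0.
have P_le : P <= C1 * N.+1%:R ^+ E.
  rewrite /C1 /E -prodr_const -big_split /=; apply: ler_prod => s _.
  rewrite mulr_ge0 //= -mulrA ler_wpM2l // -natrM ler_nat mulnC.
  by rewrite leq_mul2l leqnSn orbT.
have two_q : (2 ^+ q) ^+ J <= 6 * m%:R * A ^+ N.
  apply: le_trans qS; rewrite -exprM mulnC exprM -natrX.
  by apply: lerXn2r; rewrite ?nnegrE ?ler_nat.
have q_le : (q * d ^ 2).+1%:R <= 2 ^+ q * (d ^ 2).+1%:R :> R.
  have hq : (q < 2 ^ q)%N by exact: ltn_expl.
  rewrite -natrX -natrM ler_nat mulnS -addn1 addnC; apply: leq_add; first by rewrite expn_gt0.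
  by rewrite leq_mul2r ltnW ?orbT.
set L := leLHS; have L0 : 0 <= L by rewrite !mulr_ge0 ?exprn_ge0.
have L_le : L <= C2 * N.+1%:R ^+ E * (2 ^+ q) ^+ 2.
  rewrite /L [leRHS](_ : _ = 12 * m%:R *
    ((C1 * N.+1%:R ^+ E) * (2 ^+ q * (2 ^+ q * (d ^ 2).+1%:R)))).
    apply: ler_wpM2l; first by rewrite mulr_ge0.
    apply: ler_pM => //.
    by apply: ler_wpM2l => //; rewrite exprn_ge0.
  by rewrite /C2; ring.
have th0 : 0 <= theta by apply: ltW; apply: lt_trans th1.
(* The power [2 * j = J] turns the bound on [(2 ^+ q) ^+ J] into a usable one without extracting
   roots. *)
suff : L ^+ (2 * j) <= (theta ^+ N) ^+ (2 * j).
  by rewrite ler_pXn2r ?nnegrE ?exprn_ge0 // muln_gt0.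
apply: le_trans (_ : (C2 * N.+1%:R ^+ E * (2 ^+ q) ^+ 2) ^+ (2 * j) <= _).
  by apply: lerXn2r; rewrite ?nnegrE // !mulr_ge0 ?exprn_ge0.
rewrite [leLHS](_ : _ = C2 ^+ (2 * j) * N.+1%:R ^+ (E * (2 * j))
  * ((2 ^+ q) ^+ J) ^+ 2); last first.
  rewrite !exprMn; congr (_ * _ * _); first by rewrite -exprM.
apply: (@le_trans _ _ (C2 ^+ (2 * j) * N.+1%:R ^+ (E * (2 * j)) * (6 * m%:R * A ^+ N) ^+ 2)).
  apply: ler_wpM2l; first by rewrite mulr_ge0 // exprn_ge0.
  by apply: lerXn2r => //; rewrite nnegrE ?mulr_ge0 ?exprn_ge0.
have := hN0 N hN; set v := N.+1%:R ^+ _ => hv.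
rewrite [leLHS](_ : _ = (C2 ^+ (2 * j) * (6 * m%:R) ^+ 2 * v) * (A ^+ 2) ^+ N); last first.
  have -> : (A ^+ 2) ^+ N = (A ^+ N) ^+ 2 by rewrite -!exprM mulnC.
  by move: (C2 ^+ (2 * j)) (A ^+ N) => c2 aa; ring.
rewrite [leRHS](_ : _ = (theta ^+ j) ^+ N * (theta ^+ j) ^+ N); last first.
  by rewrite -!exprM -exprD addnn -mul2n mulnCA [(N * j)%N]mulnC.
apply: ler_pM => //; rewrite ?mulr_ge0 ?exprn_ge0 //.
by apply: lerXn2r => //; rewrite nnegrE exprn_ge0.
Qed.

(** * Matrix multiplication blocks *)

HB.instance Definition _ (G1 G2 : finZmodType) := Finite.on (G1 * G2)%type.
HB.instance Definition _ (I : finType) (G : finZmodType) := Finite.on {ffun I -> G}.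

Section Chart.
Variables (H : finZmodType) (lev : H -> nat) (top : H) (T : nat).
Hypothesis lev0 : lev 0 = 0%N.
Hypothesis lev_sub : forall a, lev (top - a) = (T - lev a)%N.
Hypothesis lev_le : forall a, (lev a <= T)%N.

(** The third variable is graded dually: for [x + y + z = 0] with [x = 0] the levels are [0],
    [lev y] and [T - lev y], which sum to [T]. *)
Definition colev (z : H) : nat := T - lev (- z).

(* The triples (x, y, z) = (a - b, b - c, c - a) of levels (i, j, k), one of which is 0,
   form the support of a matrix multiplication tensor with two trivial dimensions. *)
Definition chartA (i j : nat) : {set H} :=
  if i == 0%N then [set 0] else if j == 0%N then [set a | lev a == i] else [set top].
Definition chartB (i j : nat) : {set H} :=
  if (i == 0%N) || (j == 0%N) then [set 0] else [set b | lev (top - b) == i].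
Definition chartC (i j : nat) : {set H} :=
  if i == 0%N then [set c | lev (- c) == j] else [set 0].

Variables (i j k : nat).
Hypothesis ijk : (i + j + k = T)%N.
Hypothesis ijk0 : [|| i == 0, j == 0 | k == 0]%N.

Lemma lev_top : lev top = T.
Proof. by have := lev_sub 0; rewrite subr0 lev0 subn0. Qed.

Lemma chart_x a b : a \in chartA i j -> b \in chartB i j -> lev (a - b) = i.
Proof.
rewrite /chartA /chartB; case: (eqVneq i 0%N) => [->|_] /=.
  by rewrite !inE => /eqP-> /eqP->; rewrite subr0 lev0.
case: (eqVneq j 0%N) => _ /=; rewrite !inE.
  by move=> /eqP ha /eqP ->; rewrite subr0.
by move=> /eqP -> /eqP.
Qed.

Lemma chart_y b c : b \in chartB i j -> c \in chartC i j -> lev (b - c) = j.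
Proof.
rewrite /chartB /chartC; case: (eqVneq i 0%N) => [i0|i0] /=.
  by rewrite !inE => /eqP-> /eqP hc; rewrite sub0r.
case: (eqVneq j 0%N) => [->|j0] /=; rewrite !inE.
  by move=> /eqP -> /eqP ->; rewrite subr0 lev0.
move=> /eqP hb /eqP ->; rewrite subr0.
move: ijk ijk0 hb (lev_le b); rewrite (negPf i0) (negPf j0) lev_sub /= => e /eqP k0 e1 e2.
by lia.
Qed.

Lemma chart_z c a : c \in chartC i j -> a \in chartA i j -> colev (c - a) = k.
Proof.
rewrite /chartA /chartC /colev opprB; case: (eqVneq i 0%N) => [i0|i0] /=.
  by rewrite !inE => /eqP hc /eqP->; rewrite sub0r hc -ijk i0 add0n addKn.
case: (eqVneq j 0%N) => [j0|j0] /=; rewrite !inE => /eqP -> /eqP ha; rewrite subr0.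
  by rewrite ha -ijk j0 addn0 addKn.
by move: ijk0; rewrite ha lev_top subnn (negPf i0) (negPf j0) => /eqP.
Qed.

(** In each case two of the three sets are singletons, so the equation compares two elements of the
    remaining set. *)
Lemma chart_tpp a a' b b' c c' :
  a \in chartA i j -> b \in chartB i j -> b' \in chartB i j -> c \in chartC i j ->
  c' \in chartC i j -> a' \in chartA i j ->
  (a - b) + (b' - c) + (c' - a') = 0 -> [/\ a = a', b = b' & c = c'].
Proof.
rewrite /chartA /chartB /chartC; case: (eqVneq i 0%N) => [i0|i0] /=.
  rewrite !inE => /eqP -> /eqP -> /eqP -> _ _ /eqP ->.
  by rewrite subr0 add0r sub0r subr0 addrC => /eqP; rewrite subr_eq0 => /eqP.
case: (eqVneq j 0%N) => [j0|j0] /=; rewrite !inE.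
  move=> _ /eqP -> /eqP -> /eqP -> /eqP -> _.
  by rewrite !subr0 addr0 sub0r => /eqP; rewrite subr_eq0 => /eqP.
move=> /eqP -> _ _ /eqP -> /eqP -> /eqP ->.
rewrite subr0 sub0r addrAC [top - b]addrC addrK addrC => /eqP.
by rewrite subr_eq0 => /eqP.
Qed.

Lemma card_chart :
  (#|chartA i j| * #|chartB i j| * #|chartC i j| =
   #|[set a | lev a == if i == 0 then j else i]|)%N.
Proof.
rewrite /chartA /chartB /chartC; case: (eqVneq i 0%N) => [i0|i0] /=.
  rewrite !cards1 !mul1n -[RHS](card_imset _ (@oppr_inj H)); apply: eq_card => c.
  by rewrite inE -{2}[c]opprK (mem_imset _ _ (@oppr_inj H)) inE.
case: (eqVneq j 0%N) => [j0|j0] /=; rewrite !cards1 ?muln1 ?mul1n //.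
have inj : injective (fun b => top - b) by move=> b b' /addrI/oppr_inj.
rewrite -[RHS](card_imset _ inj); apply: eq_card => c.
by rewrite inE -{2}[c](subKr top) (mem_imset _ _ inj) inE.
Qed.

End Chart.

(** * Levels in a group and in its square *)

Section Levels.
Variables (G : finZmodType) (top : G).
Hypothesis top0 : top != 0.

Definition level (a : G) : nat := if a == 0 then 0 else if a == top then 2 else 1.

Lemma level_le a : (level a <= 2)%N.
Proof. by rewrite /level; case: ifP => // _; case: ifP. Qed.

Lemma level0 : level 0 = 0%N.
Proof. by rewrite /level eqxx. Qed.

Lemma level_sub a : level (top - a) = (2 - level a)%N.
Proof.
rewrite /level subr_eq0 [top == a]eq_sym; case: (eqVneq a top) => [->|at0].
  by rewrite (negPf top0).
rewrite -[X in _ == X]subr0 (inj_eq (addrI _)) (inj_eq oppr_inj).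
by case: ifP.
Qed.

(** If [x] or [y] is [0], the other level cancels against that of [- z]; otherwise both levels are
    at least 1. *)
Lemma level_sum x y z : x + y + z = 0 -> (2 <= level x + level y + colev level 2 z)%N.
Proof.
move=> /eqP; rewrite addr_eq0 => /eqP e; rewrite /colev -e.
have [->|x0] := eqVneq x 0; first by rewrite add0r level0; have := level_le y; lia.
have [->|y0] := eqVneq y 0; first by rewrite addr0 level0; have := level_le x; lia.
have pos a : a != 0 -> (0 < level a)%N by rewrite /level => /negPf->; case: ifP.
by have := pos x x0; have := pos y y0; lia.
Qed.

Definition level2 (a : G * G) : nat := level a.1 + level a.2.

Lemma level2_le (a : G * G) : (level2 a <= 4)%N.
Proof. exact: (leq_add (level_le a.1) (level_le a.2)). Qed.

Lemma level2_0 : level2 0 = 0%N.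
Proof. by rewrite /level2 !level0. Qed.

Lemma level2_sub (a : G * G) : level2 ((top, top) - a) = (4 - level2 a)%N.
Proof.
have -> : level2 ((top, top) - a) = (level (top - a.1)%R + level (top - a.2)%R)%N by [].
rewrite /level2 !level_sub.
by have := level_le a.1; have := level_le a.2; lia.
Qed.

Lemma colev2 (z : G * G) : colev level2 4 z = (colev level 2 z.1 + colev level 2 z.2)%N.
Proof.
have -> : colev level2 4 z = (4 - (level (- z.1)%R + level (- z.2)%R))%N by [].
rewrite /colev addnBA ?level_le // addnBAC ?level_le //.
by rewrite -subnDA addnC.
Qed.

Variable q : nat.
Hypothesis cardG : #|G| = q.+2.

Lemma sum_level (F : nat -> nat) : (\sum_a F (level a) = F 0 + F 2 + q * F 1)%N.
Proof.
have level_top : level top = 2%N by rewrite /level (negPf top0) eqxx.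
rewrite (bigD1 0) //= (bigD1 top) //= level0 level_top addnA.
congr (_ + _)%N.
rewrite (eq_bigr (fun=> F 1%N)) => [|a /andP[/negPf a0 /negPf at0]]; last first.
  by rewrite /level a0 at0.
rewrite sum_nat_const; congr (_ * _)%N.
have := cardsC [set 0; top]%SET; rewrite cardG cards2 eq_sym top0 => /eqP.
rewrite !addSn add0n !eqSS => /eqP <-; apply: eq_card => a.
by rewrite !inE negb_or.
Qed.

Lemma card_level v : (#|[set a | level a == v]| = (0 == v) + (2 == v) + q * (1 == v))%N.
Proof.
rewrite -sum1_card big_mkcond -(sum_level (fun u => (u == v) : nat)).
by apply: eq_bigr => a _; rewrite inE; case: ifP.
Qed.

Lemma card_level2 v : (#|[set a | level2 a == v]| =
  (0 == v) + (2 == v) + q * (1 == v) + ((2 == v) + (4 == v) + q * (3 == v))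
  + q * ((1 == v) + (3 == v) + q * (2 == v)))%N.
Proof.
rewrite -sum1_card big_mkcond.
transitivity (\sum_(a : G) \sum_(b : G) (level a + level b == v))%N.
  rewrite pair_big; apply: eq_bigr => a _; rewrite inE /level2.
  by case: (_ == v).
rewrite (eq_bigr _ (fun a _ => sum_level (fun u => (level a + u == v)%N : nat))).
rewrite (sum_level (fun w => (w + 0 == v) + (w + 2 == v) + q * (w + 1 == v)))%N.
by [].
Qed.

End Levels.

(** * The two symbol tables and their blocks *)

Definition tabulate (l : seq nat) (i : nat) : nat := nth 0%N l i.

(* The twelve triples (i, j, k) of levels at most 3 with i + j + k = 4. The multiplicities
   [nk1] are w_i w_j w_k for the weights w = [nw1]; up to scaling this is close to the
   distribution that optimizes the bound for 8 = 6 + 2 elements. Level 4 is left out. *)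
Definition nx1 := tabulate [:: 0; 0; 1; 3; 1; 3; 0; 2; 2; 1; 1; 2]%N.
Definition ny1 := tabulate [:: 1; 3; 0; 0; 3; 1; 2; 0; 2; 1; 2; 1]%N.
Definition nz1 := tabulate [:: 3; 1; 3; 1; 0; 0; 2; 2; 0; 2; 1; 1]%N.
Definition nk1 := tabulate [:: 8; 8; 8; 8; 8; 8; 64; 64; 64; 128; 128; 128]%N.
Definition nw1 := tabulate [:: 1; 4; 8; 2]%N.

(* Symbols 0 to 8 are the triples with a zero entry, whose blocks are not refined and get
   the dummy labels (0, 0, 0). Symbols 9 to 20 are the splittings of the triples (1, 1, 2),
   (1, 2, 1) and (2, 1, 1), labelled by the levels in the first coordinate. *)
Definition ncl2 := tabulate
  [:: 0; 1; 2; 3; 4; 5; 6; 7; 8; 9; 9; 9; 9; 10; 10; 10; 10; 11; 11; 11; 11]%N.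
Definition nx2 := tabulate
  [:: 0; 0; 0; 0; 0; 0; 0; 0; 0; 1; 0; 1; 0; 1; 0; 1; 0; 0; 2; 1; 1]%N.
Definition ny2 := tabulate
  [:: 0; 0; 0; 0; 0; 0; 0; 0; 0; 1; 0; 0; 1; 0; 2; 1; 1; 1; 0; 1; 0]%N.
Definition nz2 := tabulate
  [:: 0; 0; 0; 0; 0; 0; 0; 0; 0; 0; 2; 1; 1; 1; 0; 0; 1; 1; 0; 0; 1]%N.
Definition nk2 := tabulate
  [:: 8; 8; 8; 8; 8; 8; 64; 64; 64; 2; 2; 62; 62; 2; 2; 62; 62; 2; 2; 62; 62]%N.
Definition nvol := tabulate
  [:: 12; 12; 12; 12; 12; 12; 38; 38; 38; 6; 6; 36; 36; 6; 6; 36; 36; 6; 6; 36; 36]%N.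

Notation Sym1 := 'I_12.
Notation Sym2 := 'I_21.

Definition cl1 (s : Sym1) : 'I_1 := ord0.
Definition x1 (s : Sym1) := nx1 s.
Definition y1 (s : Sym1) := ny1 s.
Definition z1 (s : Sym1) := nz1 s.
Definition k1 (s : Sym1) := nk1 s.
Definition cl2 (s : Sym2) : Sym1 := inord (ncl2 s).
Definition x2 (s : Sym2) := nx2 s.
Definition y2 (s : Sym2) := ny2 s.
Definition z2 (s : Sym2) := nz2 s.
Definition k2 (s : Sym2) := nk2 s.

Lemma iota_all n (P : nat -> bool) : all P (iota 0 n) -> forall i : 'I_n, P i.
Proof. by move=> /allP h i; apply: h; rewrite mem_iota ltn_ord. Qed.

Lemma val_cl2 s : val (cl2 s) = ncl2 s.
Proof.
have h : all (fun i => ncl2 i < 12)%N (iota 0 21) by vm_compute.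
by rewrite /= inordK //; exact: (iota_all h s).
Qed.

Definition is_fine i := (9 <= i)%N.

(** Supplies, position by position, the word [e] to which [matched] is applied. *)
Lemma triple_exists1 (s s' s'' : Sym1) : (x1 s + y1 s' + z1 s'' = 4)%N ->
  exists e, [/\ x1 e = x1 s, y1 e = y1 s' & z1 e = z1 s''].
Proof.
have h : all (fun i => all (fun j => all (fun k => (nx1 i + ny1 j + nz1 k == 4) ==>
  has (fun e => [&& nx1 e == nx1 i, ny1 e == ny1 j & nz1 e == nz1 k]) (iota 0 12))
  (iota 0 12)) (iota 0 12)) (iota 0 12) by vm_compute.
move=> /eqP e4; have := iota_all (iota_all (iota_all h s) s') s''; rewrite e4 implyTb.
case/hasP => e; rewrite mem_iota /= => e12 /and3P[/eqP ex /eqP ey /eqP ez].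
by exists (Ordinal e12).
Qed.

Lemma triple_exists2 (s s' s'' : Sym2) : cl2 s = cl2 s' -> cl2 s = cl2 s'' ->
  (is_fine s -> x2 s + y2 s' + z2 s'' = 2)%N ->
  exists e, [/\ cl2 e = cl2 s, x2 e = x2 s, y2 e = y2 s' & z2 e = z2 s''].
Proof.
have h : all (fun i => all (fun j => all (fun k =>
    (ncl2 i == ncl2 j) ==> (ncl2 i == ncl2 k) ==>
    (is_fine i ==> (nx2 i + ny2 j + nz2 k == 2)) ==>
  has (fun e => [&& ncl2 e == ncl2 i, nx2 e == nx2 i, ny2 e == ny2 j & nz2 e == nz2 k])
  (iota 0 21)) (iota 0 21)) (iota 0 21)) (iota 0 21) by vm_compute.
move=> /(congr1 val); rewrite !val_cl2 => e1 /(congr1 val); rewrite !val_cl2 => e2 e3.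
have := iota_all (iota_all (iota_all h s) s') s''; rewrite -e1 -e2 eqxx !implyTb.
have -> : is_fine s ==> (nx2 s + ny2 s' + nz2 s'' == 2)%N.
  by apply/implyP => /e3 /eqP.
rewrite implyTb.
case/hasP => e; rewrite mem_iota /= => e21 /and4P[/eqP ec /eqP ex /eqP ey /eqP ez].
exists (Ordinal e21); split=> //; apply/val_inj; rewrite !val_cl2; exact: ec.
Qed.

Definition cx i := nx1 (ncl2 i).
Definition cy i := ny1 (ncl2 i).
Definition cz i := nz1 (ncl2 i).

Notation G8 := 'I_8.
Notation one8 := (1 : G8).
Notation lev8 := (level one8).
Notation lev64 := (level2 one8).

Lemma one8_neq0 : one8 != 0. Proof. by []. Qed.

(** A refined block is a product of two charts, one per component, whose levels add up to the coarse
    ones; an unrefined block is a single chart of the group of pairs. *)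
Definition charted (ch : forall H : finZmodType, (H -> nat) -> H -> nat -> nat -> {set H})
    (i : nat) : {set G8 * G8} :=
  if is_fine i then
    finset.setX (ch _ lev8 one8 (nx2 i) (ny2 i))
                (ch _ lev8 one8 (cx i - nx2 i)%N (cy i - ny2 i)%N)
  else ch _ lev64 (one8, one8) (cx i) (cy i).

Definition symA := charted chartA.
Definition symB := charted chartB.
Definition symC := charted (fun H lev _ => chartC lev).

Definition coarse_ok i :=
  (cx i + cy i + cz i == 4) && [|| cx i == 0, cy i == 0 | cz i == 0]%N.
Definition fine_ok i :=
  [&& nx2 i + ny2 i + nz2 i == 2, [|| nx2 i == 0, ny2 i == 0 | nz2 i == 0],
      (cx i - nx2 i) + (cy i - ny2 i) + (cz i - nz2 i) == 2,
      [|| cx i - nx2 i == 0, cy i - ny2 i == 0 | cz i - nz2 i == 0],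
      nx2 i <= cx i, ny2 i <= cy i & nz2 i <= cz i]%N.

Lemma sym_ok (s : Sym2) : if is_fine s then fine_ok s else coarse_ok s.
Proof.
have h : all (fun i => if is_fine i then fine_ok i else coarse_ok i) (iota 0 21) by vm_compute.
exact: (iota_all h).
Qed.

Section SymbolCharts.
Variable s : Sym2.
Implicit Types a b c : G8 * G8.

Let l0 := level0 one8.
Let ls := level_sub one8_neq0.
Let ll := level_le one8.
Let L0 := level2_0 one8.
Let Ls := level2_sub one8_neq0.
Let Ll := level2_le one8.

Lemma sym_x a b : a \in symA s -> b \in symB s ->
  lev64 (a - b) = cx s /\ (is_fine s -> lev8 (a - b).1 = x2 s).
Proof.
have := sym_ok s; rewrite /symA /symB /charted; case: ifP => _.
  case/and5P => /eqP s1 z1 /eqP s2 z2 /and3P[le1 _ _]; rewrite !inE.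
  move=> /andP[a1 a2] /andP[b1 b2].
  have e1 := chart_x l0 a1 b1; have e2 := chart_x l0 a2 b2.
  by rewrite /level2 [lev8 (a - b).1]e1 [lev8 (a - b).2]e2 subnKC.
by case/andP => /eqP s1 z1 a1 b1; split=> //; exact: (chart_x L0 a1 b1).
Qed.

Lemma sym_y b c : b \in symB s -> c \in symC s ->
  lev64 (b - c) = cy s /\ (is_fine s -> lev8 (b - c).1 = y2 s).
Proof.
have := sym_ok s; rewrite /symB /symC /charted; case: ifP => _.
  case/and5P => /eqP s1 z1 /eqP s2 z2 /and3P[_ le1 _]; rewrite !inE.
  move=> /andP[a1 a2] /andP[b1 b2].
  have e1 := chart_y l0 ls ll s1 z1 a1 b1; have e2 := chart_y l0 ls ll s2 z2 a2 b2.
  by rewrite /level2 [lev8 (b - c).1]e1 [lev8 (b - c).2]e2 subnKC.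
by case/andP => /eqP s1 z1 a1 b1; split=> //; exact: (chart_y L0 Ls Ll s1 z1 a1 b1).
Qed.

Lemma sym_z c a : c \in symC s -> a \in symA s ->
  colev lev64 4 (c - a) = cz s /\ (is_fine s -> colev lev8 2 (c - a).1 = z2 s).
Proof.
have := sym_ok s; rewrite /symA /symC /charted; case: ifP => _.
  case/and5P => /eqP s1 z1 /eqP s2 z2 /and3P[_ _ le1]; rewrite !inE.
  move=> /andP[a1 a2] /andP[b1 b2].
  have e1 := chart_z l0 ls s1 z1 a1 b1; have e2 := chart_z l0 ls s2 z2 a2 b2.
  have E1 : colev lev8 2 (c - a).1 = nz2 s := e1.
  have E2 : colev lev8 2 (c - a).2 = (cz s - nz2 s)%N := e2.
  by split=> //; rewrite (colev2 one8 (c - a)) E1 E2 subnKC.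
by case/andP => /eqP s1 z1 a1 b1; split=> //; exact: (chart_z L0 Ls s1 z1 a1 b1).
Qed.

Lemma sym_tpp a a' b b' c c' :
  a \in symA s -> b \in symB s -> b' \in symB s -> c \in symC s ->
  c' \in symC s -> a' \in symA s ->
  (a - b) + (b' - c) + (c' - a') = 0 -> [/\ a = a', b = b' & c = c'].
Proof.
rewrite /symA /symB /symC /charted; case: ifP => _; last exact: chart_tpp.
rewrite !inE => /andP[a1 a2] /andP[b1 b2] /andP[b1' b2'] /andP[c1 c2]
  /andP[c1' c2'] /andP[a1' a2'] e.
have [ea1 eb1 ec1] := chart_tpp a1 b1 b1' c1 c1' a1' (congr1 fst e).
have [ea2 eb2 ec2] := chart_tpp a2 b2 b2' c2 c2' a2' (congr1 snd e).
move: ea1 eb1 ec1 ea2 eb2 ec2.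
by case: a {a1 a2 e} => ? ?; case: b {b1 b2} => ? ?; case: c {c1 c2} => ? ?;
   case: a' {a1' a2'} => ? ?; case: b' {b1' b2'} => ? ?; case: c' {c1' c2'} => ? ? /=
   -> -> -> -> -> ->.
Qed.

Lemma sym_vol : (#|symA s| * #|symB s| * #|symC s| = nvol s)%N.
Proof.
have c8 : #|G8| = 8%N by rewrite card_ord.
have h : all (fun i => if is_fine i then
    let v1 := if nx2 i == 0%N then ny2 i else nx2 i in
    let v2 := if (cx i - nx2 i == 0)%N then (cy i - ny2 i)%N else (cx i - nx2 i)%N in
    ((0 == v1) + (2 == v1) + 6 * (1 == v1)) * ((0 == v2) + (2 == v2) + 6 * (1 == v2)) == nvol i
  else
    let v := if cx i == 0%N then cy i else cx i in
    (0 == v) + (2 == v) + 6 * (1 == v) + ((2 == v) + (4 == v) + 6 * (3 == v))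
      + 6 * ((1 == v) + (3 == v) + 6 * (2 == v)) == nvol i)%N (iota 0 21) by vm_compute.
have := iota_all h s; rewrite /symA /symB /symC /charted; case: ifP => _ /eqP <-.
  rewrite !cardsX [X in (X * _)%N]mulnACA mulnACA.
  rewrite (card_chart lev8 one8) (card_chart lev8 one8).
  by rewrite !(card_level one8_neq0 c8).
by rewrite (card_chart lev64) (card_level2 one8_neq0 c8).
Qed.

End SymbolCharts.

(** * Combining both extractions into one triple product family *)

Lemma type_class_sum (K Sym : finType) (cl : Sym -> K) n N (ka : {ffun 'I_n -> K})
    (k : Sym -> nat) t (F : Sym -> nat) : t \in type_class cl ka (fun s => N * k s)%N ->
  (\sum_p F (t p) = N * \sum_s F s * k s)%N.
Proof.
rewrite inE => /andP[_ /forallP hk].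
rewrite (partition_big t predT) //= big_distrr /=; apply: eq_bigr => s _.
rewrite mulnCA -(eqP (hk s)) mulnC -sum_nat_const.
by apply: eq_big => [p|p /eqP-> //]; rewrite !inE.
Qed.

Lemma type_class_prodn (K Sym : finType) (cl : Sym -> K) n N (ka : {ffun 'I_n -> K})
    (k : Sym -> nat) t (F : Sym -> nat) : t \in type_class cl ka (fun s => N * k s)%N ->
  (\prod_p F (t p) = (\prod_s F s ^ k s) ^ N)%N.
Proof.
rewrite inE => /andP[_ /forallP hk].
rewrite (partition_big t predT) //=.
rewrite (big_morph (fun m => m ^ N)%N (fun a b => expnMn a b N) (exp1n N)).
apply: eq_bigr => s _.
rewrite -expnM mulnC -(eqP (hk s)) -prod_nat_const.
by apply: eq_big => [p|p /eqP-> //]; rewrite !inE.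
Qed.

Lemma sum_iota n (P : pred nat) (F : nat -> nat) :
  (\sum_(s < n | P s) F s = sumn [seq F i | i <- iota 0 n & P i])%N.
Proof.
by rewrite -(big_mkord P F) sumnE big_map big_filter /index_iota subn0.
Qed.

Lemma eq_of_sum_eq n (a : 'I_n -> nat) d :
  (forall p, d <= a p)%N -> (\sum_p a p = n * d)%N -> forall p, a p = d.
Proof.
move=> ge eq p; apply/eqP; rewrite eqn_leq ge andbT.
have : (\sum_p (a p - d) = 0)%N.
  by rewrite sumnB => [|i _]; rewrite ?ge // eq sum_nat_const card_ord subnn.
by move=> /eqP; rewrite sum_nat_eq0 => /forallP/(_ p); rewrite subn_eq0.
Qed.

Definition unit_classes n : {ffun 'I_n -> 'I_1} := [ffun=> ord0].

Lemma fine_cl (s : Sym2) : is_fine s = (9 <= ncl2 s)%N.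
Proof.
have h : all (fun i => is_fine i == (9 <= ncl2 i)%N) (iota 0 21) by vm_compute.
exact: (eqP (iota_all h s)).
Qed.

Section Assembly.
Variables (n N : nat) (S1 : {set {ffun 'I_n -> Sym1}}).
Variable S2 : {ffun 'I_n -> Sym1} -> {set {ffun 'I_n -> Sym2}}.
Hypothesis n_eq : n = (N * 624)%N.
Hypothesis S1_type : S1 \subset type_class cl1 (unit_classes n) (fun s => N * k1 s)%N.
Hypothesis S1_matched : matched cl1 x1 y1 z1 (unit_classes n) S1.
Hypothesis S2_type : forall t, t \in S1 -> S2 t \subset type_class cl2 t (fun s => N * k2 s)%N.
Hypothesis S2_matched : forall t, t \in S1 -> matched cl2 x2 y2 z2 t (S2 t).

Definition coarse (s : {ffun 'I_n -> Sym2}) : {ffun 'I_n -> Sym1} := [ffun p => cl2 (s p)].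

Definition words := [set s | (coarse s \in S1) && (s \in S2 (coarse s))].

Lemma card_words : (#|words| = \sum_(t in S1) #|S2 t|)%N.
Proof.
rewrite -sum1_card (partition_big coarse (mem S1)) /= => [|s]; last first.
  by rewrite inE => /andP[].
apply: eq_bigr => t tS; rewrite -sum1_card; apply: eq_bigl => s; rewrite inE.
apply/andP/idP => [[/andP[_ +] /eqP <-] //|sS].
have ct : coarse s = t.
  have := fintype.subsetP (S2_type tS) _ sS; rewrite inE => /andP[/forallP h _].
  by apply/ffunP => p; rewrite ffunE; exact/eqP.
by rewrite ct tS sS eqxx.
Qed.

Let I := {s | s \in words}.
Let A (i : I) := family_set (fun p => symA (val i p)).
Let B (i : I) := family_set (fun p => symB (val i p)).
Let C (i : I) := family_set (fun p => symC (val i p)).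

Lemma words_coarse (i : I) : coarse (val i) \in S1.
Proof. by have := valP i; rewrite inE => /andP[]. Qed.

Lemma words_fine (i : I) : val i \in S2 (coarse (val i)).
Proof. by have := valP i; rewrite inE => /andP[]. Qed.

Lemma coarse_type (i : I) :
  coarse (val i) \in type_class cl1 (unit_classes n) (fun s => N * k1 s)%N.
Proof. exact: fintype.subsetP S1_type _ (words_coarse i). Qed.

Lemma fine_type (i : I) : val i \in type_class cl2 (coarse (val i)) (fun s => N * k2 s)%N.
Proof. exact: fintype.subsetP (S2_type (words_coarse i)) _ (words_fine i). Qed.

(** The prescribed type fixes the total level of any word in each of the three directions at
    [832 * N], and [3 * 832 = 4 * 624]. *)
Lemma coarse_sum (i j k : I) : (\sum_p (cx (val i p) + cy (val j p) + cz (val k p)) = n * 4)%N.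
Proof.
have tot (F : nat -> nat) (l : I) : sumn [seq F s * nk1 s | s <- iota 0 12] = 832%N ->
    (\sum_p F (ncl2 (val l p)) = N * 832)%N.
  move=> e; have := type_class_sum (fun s : Sym1 => F s) (coarse_type l).
  rewrite (sum_iota 12 predT (fun s => F s * nk1 s)%N) filter_predT e => <-.
  by apply: eq_bigr => p _; rewrite ffunE val_cl2.
rewrite !big_split /=; rewrite !tot ?n_eq; try by vm_compute.
by rewrite -!mulnDr -mulnA.
Qed.

(** Levels are at least 2 in each component of each position, and their total is exactly [4 * n], so
    equality holds throughout. The coarse matching then identifies the coarse words, the fine
    matching the words, and [sym_tpp] the elements. *)
Lemma words_stpp : stpp A B C.
Proof.
move=> i j k a b b' c c' a' ha hb hb' hc hc' ha' e.
change {ffun 'I_n -> 'I_8 * 'I_8} in a, b, b', c, c', a'.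
have mem (X : nat -> {set 'I_8 * 'I_8}) (l : I) (v : {ffun 'I_n -> 'I_8 * 'I_8}) :
    v \in family_set (fun p => X (val l p)) -> forall p, v p \in X (val l p).
  by rewrite inE => /forallP.
have hx p := sym_x (mem _ _ _ ha p) (mem _ _ _ hb p).
have hy p := sym_y (mem _ _ _ hb' p) (mem _ _ _ hc p).
have hz p := sym_z (mem _ _ _ hc' p) (mem _ _ _ ha' p).
have ep p : (a p - b p) + (b' p - c p) + (c' p - a' p) = 0.
  by have /ffunP/(_ p) := e; rewrite !ffunE.
have ep1 p := congr1 fst (ep p); have ep2 p := congr1 snd (ep p).
have l1 p := level_sum one8_neq0 (ep1 p); have l2 p := level_sum one8_neq0 (ep2 p).
pose u p := a p - b p; pose v p := b' p - c p; pose w p := c' p - a' p.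
have sum_levels p : (cx (val i p) + cy (val j p) + cz (val k p) =
    (level one8 (u p).1 + level one8 (v p).1 + colev (level one8) 2 (w p).1) +
    (level one8 (u p).2 + level one8 (v p).2 + colev (level one8) 2 (w p).2))%N.
  rewrite -(hx p).1 -(hy p).1 -(hz p).1 (colev2 _ (w p)).
  by rewrite /level2 /u /v /w [X in (X + _)%N]addnACA addnACA.
have lev4 : forall p, (cx (val i p) + cy (val j p) + cz (val k p) = 4)%N.
  apply: eq_of_sum_eq (coarse_sum i j k) => p; rewrite sum_levels.
  exact: (leq_add (l1 p) (l2 p)).
have lev2 p : (level one8 (u p).1 + level one8 (v p).1
    + colev (level one8) 2 (w p).1 = 2)%N.
  have two x y : (2 <= x -> 2 <= y -> x + y = 4 -> x = 2)%N.
    by clear; move=> ? ? ?; lia.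
  exact: two (l1 p) (l2 p) (etrans (esym (sum_levels p)) (lev4 p)).
have cE (l : I) p : (coarse (val l) p : nat) = ncl2 (val l p) by rewrite ffunE val_cl2.
have [eij ejk] : coarse (val i) = coarse (val j) /\ coarse (val j) = coarse (val k).
  have ex p : exists e, [/\ x1 e = x1 (coarse (val i) p), y1 e = y1 (coarse (val j) p)
      & z1 e = z1 (coarse (val k) p)].
    (* The coarse levels sum to 4 at every position, so they form a listed triple. *)
    by apply: triple_exists1; rewrite /x1 /y1 /z1 !cE; exact: lev4.
  have [f hf] := choice ex.
  apply: (S1_matched (words_coarse i) (words_coarse j) (words_coarse k) (e := finfun f)) => p;
    [by rewrite !ffunE | | |]; by rewrite (ffunE f); have [] := hf p.
have [sij sjk] : val i = val j /\ val j = val k.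
  have ej : val j \in S2 (coarse (val i)) by rewrite eij; exact: words_fine.
  have ek : val k \in S2 (coarse (val i)) by rewrite eij ejk; exact: words_fine.
  have clE (l : I) p : coarse (val l) = coarse (val i) -> cl2 (val l p) = cl2 (val i p).
    by move=> /ffunP/(_ p); rewrite !ffunE.
  have ex p : exists e, [/\ cl2 e = cl2 (val i p), x2 e = x2 (val i p), y2 e = y2 (val j p)
      & z2 e = z2 (val k p)].
    apply: triple_exists2; rewrite ?(clE j) ?(clE k) ?eij ?ejk // => fi.
    have nij : ncl2 (val j p) = ncl2 (val i p) by rewrite -!val_cl2 (clE j) ?eij.
    have nik : ncl2 (val k p) = ncl2 (val i p) by rewrite -!val_cl2 (clE k) ?eij ?ejk.
    have fj : is_fine (val j p) by rewrite fine_cl nij -fine_cl.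
    have fk : is_fine (val k p) by rewrite fine_cl nik -fine_cl.
    (* For a refined block the first components have total level exactly 2, as the splitting
       requires. *)
    have := lev2 p; rewrite /u /v /w.
    by rewrite ((hx p).2 fi) ((hy p).2 fj) ((hz p).2 fk).
  have [f hf] := choice ex.
  apply: (S2_matched (words_coarse i) (words_fine i) ej ek (e := finfun f)) => p;
    rewrite (ffunE f) ?[coarse _ p]ffunE; by have [] := hf p.
have {sij} sij : i = j by exact: val_inj.
have {sjk} sjk : j = k by exact: val_inj.
subst j k; split => //.
all: apply/ffunP => p; have [] := sym_tpp (mem _ _ _ ha p) (mem _ _ _ hb p) (mem _ _ _ hb' p)
  (mem _ _ _ hc p) (mem _ _ _ hc' p) (mem _ _ _ ha' p) (ep p); by [].
Qed.

Lemma words_vol (i : I) : (#|A i| * #|B i| * #|C i| = (\prod_(s < 21) nvol s ^ nk2 s) ^ N)%N.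
Proof.
rewrite !card_family_set -!big_split /=.
rewrite -(type_class_prodn (fun s : Sym2 => nvol s) (fine_type i)).
by apply: eq_bigr => p _; exact: sym_vol.
Qed.

End Assembly.

(** * Numerical bounds *)

Section ListProducts.
Variable R : realType.

(** Pairs of a base and an exponent keep the huge powers symbolic. *)
Definition wprod (l : seq (nat * nat)) : R := \prod_(p <- l) p.1%:R ^+ p.2.

Lemma prod_by_value n (a k : nat -> nat) (vals : seq nat) : uniq vals ->
  all (fun i => a i \in vals) (iota 0 n) ->
  \prod_(s < n) (a s)%:R ^+ k s =
  wprod [seq (v, sumn [seq k i | i <- iota 0 n & a i == v]) | v <- vals].
Proof.
move=> uv /iota_all av; rewrite /wprod big_map /=.
have e v : v%:R ^+ sumn [seq k i | i <- iota 0 n & a i == v]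
    = \prod_(s < n | a s == v) v%:R ^+ k s :> R.
  by rewrite -(sum_iota n (fun i => a i == v)) expr_sum.
under [in RHS]eq_bigr => v _ do rewrite e.
rewrite (exchange_big_dep predT) //=; apply: eq_bigr => s _.
rewrite -big_filter (eq_filter (a2 := pred1 (a s))) => [|v]; last by rewrite /= eq_sym.
by rewrite filter_pred1_uniq // ?big_seq1 //; exact: av.
Qed.

Lemma ln_wprod (l : seq (nat * nat)) : all (fun p => 0 < p.1)%N l ->
  0 < wprod l /\ ln (wprod l) = \sum_(p <- l) p.2%:R * ln p.1%:R.
Proof.
rewrite /wprod; elim: l => [|p l IH] /=; first by rewrite !big_nil ln1.
move=> /andP[p0 /IH[l0 e]]; rewrite !big_cons.
have pp : 0 < p.1%:R ^+ p.2 :> R by rewrite exprn_gt0 // ltr0n.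
split; first by rewrite mulr_gt0.
by rewrite lnM ?posrE // e lnXn ?ltr0n // mulr_natl.
Qed.

Lemma fiber_wprod n (K : finType) (cl : 'I_n -> K) (ncl k l : nat -> nat) (vals : seq nat) :
  (forall s s', (cl s == cl s') = (ncl s == ncl s')) ->
  let fib i := sumn [seq k j | j <- iota 0 n & (ncl j == ncl i) && (l j == l i)] in
  uniq vals -> all (fun i => fib i \in vals) (iota 0 n) ->
  \prod_s (fiber_weight cl (fun s => k s) (fun s => l s) s)%:R ^+ k s =
  wprod [seq (v, sumn [seq k i | i <- iota 0 n & fib i == v]) | v <- vals].
Proof.
move=> cle fib uv av; rewrite -prod_by_value //; apply: eq_bigr => s _.
congr (_%:R ^+ _); rewrite /fiber_weight /fib.
rewrite -(sum_iota n (fun j => (ncl j == ncl s) && (l j == l s))).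
by apply: eq_bigl => j; rewrite cle.
Qed.

Lemma class_wprod n m (cl : 'I_n -> 'I_m) (ncl k : nat -> nat) (vals : seq nat) :
  (forall s, val (cl s) = ncl s) ->
  let size i := sumn [seq k j | j <- iota 0 n & ncl j == i] in
  uniq vals -> all (fun i => size i \in vals) (iota 0 m) ->
  class_weight R cl (fun s => k s) =
  wprod [seq (v, sumn [seq size i | i <- iota 0 m & size i == v]) | v <- vals].
Proof.
move=> cle size uv av; rewrite -prod_by_value //; apply: eq_bigr => a _.
have -> // : class_size cl (fun s => k s) a = size a.
rewrite /class_size /size -(sum_iota n (fun j => ncl j == a)).
by apply: eq_bigl => j; rewrite -val_eqE cle.
Qed.

(** The bases are the marginals of [k1] at levels 0, 1, 2 and 3, equal in the three directions. *)
Definition A1 : R := wprod [:: (80, 80); (272, 272); (256, 256); (16, 16)].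
Definition A2 : R := wprod [:: (8, 48); (64, 448); (2, 4); (124, 124)].
Definition W1 : R := wprod [:: (624, 624)].
Definition W2 : R := wprod [:: (8, 48); (64, 192); (128, 384)].
Definition V : R := wprod [:: (12, 48); (38, 192); (6, 12); (36, 372)].

Lemma fiber1 (l : nat -> nat) :
  let fib i := sumn [seq nk1 j | j <- iota 0 12 & l j == l i] in
  all (fun i => fib i \in [:: 80; 272; 256; 16]%N) (iota 0 12) ->
  [seq (v, sumn [seq nk1 i | i <- iota 0 12 & fib i == v]) | v <- [:: 80; 272; 256; 16]]
    = [:: (80, 80); (272, 272); (256, 256); (16, 16)] ->
  \prod_s (fiber_weight cl1 k1 (fun s => l s) s)%:R ^+ k1 s <= A1.
Proof.
move=> fib h e; rewrite /A1 -e.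
have cle (s s' : Sym1) : (cl1 s == cl1 s') = (0%N == 0%N) by rewrite !eqxx.
by rewrite (@fiber_wprod _ _ cl1 (fun=> 0%N) nk1 l [:: 80; 272; 256; 16]%N cle).
Qed.

Lemma fiber2 (l : nat -> nat) :
  let fib i := sumn [seq nk2 j | j <- iota 0 21 & (ncl2 j == ncl2 i) && (l j == l i)] in
  all (fun i => fib i \in [:: 8; 64; 2; 124]%N) (iota 0 21) ->
  [seq (v, sumn [seq nk2 i | i <- iota 0 21 & fib i == v]) | v <- [:: 8; 64; 2; 124]]
    = [:: (8, 48); (64, 448); (2, 4); (124, 124)] ->
  \prod_s (fiber_weight cl2 k2 (fun s => l s) s)%:R ^+ k2 s <= A2.
Proof.
move=> fib h e; rewrite /A2 -e.
have cle (s s' : Sym2) : (cl2 s == cl2 s') = (ncl2 s == ncl2 s').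
  by rewrite -val_eqE !val_cl2.
by rewrite (@fiber_wprod _ _ cl2 ncl2 nk2 l [:: 8; 64; 2; 124]%N cle).
Qed.

Lemma class_weight1 : class_weight R cl1 k1 = W1.
Proof. by rewrite (@class_wprod _ _ cl1 (fun=> 0%N) nk1 [:: 624]%N). Qed.

Lemma class_weight2 : class_weight R cl2 k2 = W2.
Proof. by rewrite (@class_wprod _ _ cl2 ncl2 nk2 [:: 8; 64; 128]%N) //; exact: val_cl2. Qed.

Lemma volume_wprod : (\prod_(s < 21) nvol s ^ nk2 s)%:R = V.
Proof.
rewrite natr_prod; under eq_bigr => s _ do rewrite natrX.
by rewrite (@prod_by_value _ _ _ [:: 12; 38; 6; 36]%N).
Qed.

Lemma class_size1 a : class_size cl1 k1 a = 624%N.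
Proof.
rewrite /class_size (eq_bigl predT) => [|s]; last by rewrite !ord1.
by rewrite (sum_iota 12 predT nk1) filter_predT.
Qed.

Lemma class_size2 a : class_size cl2 k2 a = k1 a.
Proof.
have h : all (fun a => sumn [seq nk2 j | j <- iota 0 21 & ncl2 j == a] == nk1 a) (iota 0 12).
  by vm_compute.
rewrite /k1 -(eqP (iota_all h a)) -(sum_iota 21 (fun j => ncl2 j == a)).
by apply: eq_bigl => j; rewrite -val_eqE val_cl2.
Qed.

(** The order of the group for [N = 1]. *)
Definition G1 : R := wprod [:: (64, 624)].

(** The exponent is [2.376 / 3]. After taking logarithms this is a linear inequality in logarithms
    of the primes 2, 3, 5, 13, 17, 19 and 31. *)
Lemma gain : A1 * A2 * G1 < W1 * W2 * V `^ (792 / 1000).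
Proof.
have [A1p A1e] : 0 < A1 /\ _ := ln_wprod (l := [:: (80, 80); (272, 272); (256, 256); (16, 16)]) isT.
have [A2p A2e] : 0 < A2 /\ _ := ln_wprod (l := [:: (8, 48); (64, 448); (2, 4); (124, 124)]) isT.
have [W1p W1e] : 0 < W1 /\ _ := ln_wprod (l := [:: (624, 624)]) isT.
have [W2p W2e] : 0 < W2 /\ _ := ln_wprod (l := [:: (8, 48); (64, 192); (128, 384)]) isT.
have [Vp Ve] : 0 < V /\ _ := ln_wprod (l := [:: (12, 48); (38, 192); (6, 12); (36, 372)]) isT.
have [G1p G1e] : 0 < G1 /\ _ := ln_wprod (l := [:: (64, 624)]) isT.
rewrite !big_cons !big_nil /= -/A1 -/A2 -/W1 -/W2 -/V -/G1 in A1e A2e W1e W2e Ve G1e.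
move: A1 A2 W1 W2 V G1 A1p A2p W1p W2p Vp G1p A1e A2e W1e W2e Ve G1e.
move=> a1 a2 w1 w2 v g1 a1p a2p w1p w2p vp g1p a1e a2e w1e w2e ve g1e.
have vtp := powR_gt0 (792 / 1000) vp.
have lp : 0 < a1 * a2 * g1 by rewrite !mulr_gt0.
have rp : 0 < w1 * w2 * v `^ (792 / 1000) by rewrite !mulr_gt0.
rewrite -ltr_ln ?posrE // !lnM ?posrE ?mulr_gt0 // ln_powR.
rewrite a1e a2e w1e w2e ve g1e {a1e a2e w1e w2e ve g1e lp rp vtp}.
have mon (a b p q : nat) : (0 < p)%N -> (0 < q)%N -> p%:R ^+ a <= q%:R ^+ b :> R ->
    a%:R * ln p%:R <= b%:R * ln q%:R :> R.
  move=> p0 q0 h; rewrite !mulr_natl -!lnXn ?ltr0n //.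
  by rewrite ler_ln ?posrE ?exprn_gt0 ?ltr0n.
(* Rational bounds on logarithms to base 2: from below for 3, 13 and 19, which favour the right
   side, and from above for 5, 17 and 31, which occur on the left. *)
have b3 : 84%:R * ln 2%:R <= 53%:R * ln 3%:R :> R by apply: mon => //; lra.
have b5 : 31%:R * ln 5%:R <= 72%:R * ln 2%:R :> R by apply: mon => //; lra.
have b13 : 877%:R * ln 2%:R <= 237%:R * ln 13%:R :> R by apply: mon => //; lra.
have b17 : 80%:R * ln 17%:R <= 327%:R * ln 2%:R :> R by apply: mon => //; lra.
have b19 : 497%:R * ln 2%:R <= 117%:R * ln 19%:R :> R by apply: mon => //; lra.
have b31 : 22%:R * ln 31%:R <= 109%:R * ln 2%:R :> R by apply: mon => //; lra.
have l2 : 0 < ln 2%:R :> R by rewrite ln_gt0 // ltr1n.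
have lnm (a b : nat) : (0 < a)%N -> (0 < b)%N -> ln (a * b)%:R = ln a%:R + ln b%:R :> R.
  by move=> a0 b0; rewrite natrM lnM ?posrE ?ltr0n.
have l4 : ln 4%:R = ln 2%:R + ln 2%:R :> R := lnm 2 2 isT isT.
have l8 : ln 8%:R = ln 2%:R + ln 4%:R :> R := lnm 2 4 isT isT.
have l16 : ln 16%:R = ln 4%:R + ln 4%:R :> R := lnm 4 4 isT isT.
have l64 : ln 64%:R = ln 8%:R + ln 8%:R :> R := lnm 8 8 isT isT.
have l128 : ln 128%:R = ln 2%:R + ln 64%:R :> R := lnm 2 64 isT isT.
have l256 : ln 256%:R = ln 4%:R + ln 64%:R :> R := lnm 4 64 isT isT.
have l80 : ln 80%:R = ln 5%:R + ln 16%:R :> R := lnm 5 16 isT isT.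
have l272 : ln 272%:R = ln 17%:R + ln 16%:R :> R := lnm 17 16 isT isT.
have l124 : ln 124%:R = ln 4%:R + ln 31%:R :> R := lnm 4 31 isT isT.
have l6 : ln 6%:R = ln 2%:R + ln 3%:R :> R := lnm 2 3 isT isT.
have l12 : ln 12%:R = ln 2%:R + ln 6%:R :> R := lnm 2 6 isT isT.
have l36 : ln 36%:R = ln 6%:R + ln 6%:R :> R := lnm 6 6 isT isT.
have l38 : ln 38%:R = ln 2%:R + ln 19%:R :> R := lnm 2 19 isT isT.
have l39 : ln 39%:R = ln 3%:R + ln 13%:R :> R := lnm 3 13 isT isT.
have l624 : ln 624%:R = ln 16%:R + ln 39%:R :> R := lnm 16 39 isT isT.
rewrite l624 l39 l38 l36 l12 l6 l124 l272 l80 l256 l128 l64 l16 l8 l4.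
move: (ln 2%:R) (ln 3%:R) (ln 5%:R) (ln 13%:R) (ln 17%:R) (ln 19%:R) (ln 31%:R)
  b3 b5 b13 b17 b19 b31 l2 => v2 v3 v5 v13 v17 v19 v31 b3 b5 b13 b17 b19 b31 l2.
clear -b3 b5 b13 b17 b19 b31 l2.
lra.
Qed.

End ListProducts.

Section FinalBound.
Variable R : realType.

(** Factors of [k2] for [k_prod]. In classes 9, 10 and 11 the multiplicity depends only on the level
    in the direction whose coarse level is 2, namely [z], [y] and [x]; the whole multiplicity of an
    unrefined class is put on the [x] factor. *)
Definition block_weight (i : nat) (a v : nat) : nat :=
  if a == i then (if v == 1 then 62 else 2)%N else if (a < 9)%N then
    (if i == 11 then nk1 a else 1)%N else 1%N.

Lemma laser1 (theta : R) : 1 < theta ->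
  exists N0, forall N, (N0 <= N)%N -> (0 < N)%N ->
    exists S : {set {ffun 'I_(N * 624) -> Sym1}},
      [/\ S \subset type_class cl1 (unit_classes (N * 624)) (fun s => N * k1 s)%N,
          matched cl1 x1 y1 z1 (unit_classes (N * 624)) S
        & W1 R ^+ N <= A1 R ^+ N * #|S|%:R * theta ^+ N].
Proof.
move=> th1.
have hk : all (fun i => 0 < nk1 i)%N (iota 0 12) by vm_compute.
have hs : all (fun i => nx1 i + ny1 i + nz1 i == 4)%N (iota 0 12) by vm_compute.
have hx : all (fun i => nx1 i <= 4)%N (iota 0 12) by vm_compute.
have hy : all (fun i => ny1 i <= 4)%N (iota 0 12) by vm_compute.
have hi : all (fun i => all (fun j => (nx1 i == nx1 j) ==> (ny1 i == ny1 j) ==> (i == j))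
  (iota 0 12)) (iota 0 12) by vm_compute.
have hp : all (fun i => nk1 i == nw1 (nx1 i) * nw1 (ny1 i) * nw1 (nz1 i))%N (iota 0 12).
  by vm_compute.
have [N0 hN0] := @laser R _ _ cl1 x1 y1 z1 (fun=> 4%N) k1 (fun=> nw1) (fun=> nw1) (fun=> nw1)
  (A1 R) theta (iota_all hk) (fun s => eqP (iota_all hs s)) (iota_all hx) (iota_all hy)
  (fun s s' _ ex ey => val_inj (eqP (implyP (implyP (iota_all (iota_all hi s) s')
    (introT eqP ex)) (introT eqP ey)))) (fun s => eqP (iota_all hp s))
  (@fiber1 R nx1 isT erefl) (@fiber1 R ny1 isT erefl) (@fiber1 R nz1 isT erefl) th1.
exists N0 => N hN N_gt0.
have [a|S [ST SM Sc]] := hN0 N hN N_gt0 _ (unit_classes (N * 624)).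
  rewrite class_size1 -[RHS]card_ord; apply: eq_card => p.
  by rewrite inE !ord1 eqxx.
by exists S; rewrite -class_weight1.
Qed.

Lemma laser2 (theta : R) : 1 < theta ->
  exists N0, forall N, (N0 <= N)%N -> (0 < N)%N -> forall n (t : {ffun 'I_n -> Sym1}),
    (forall a, #|[set p | t p == a]| = N * k1 a)%N ->
    exists S : {set {ffun 'I_n -> Sym2}},
      [/\ S \subset type_class cl2 t (fun s => N * k2 s)%N,
          matched cl2 x2 y2 z2 t S
        & W2 R ^+ N <= A2 R ^+ N * #|S|%:R * theta ^+ N].
Proof.
move=> th1.
pose c (a : nat) := if (9 <= a)%N then 2%N else 0%N.
have hk : all (fun i => 0 < nk2 i)%N (iota 0 21) by vm_compute.
have hs : all (fun i => nx2 i + ny2 i + nz2 i == c (ncl2 i))%N (iota 0 21) by vm_compute.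
have hx : all (fun i => nx2 i <= 4)%N (iota 0 21) by vm_compute.
have hy : all (fun i => ny2 i <= 4)%N (iota 0 21) by vm_compute.
have hi : all (fun i => all (fun j => (ncl2 i == ncl2 j) ==> (nx2 i == nx2 j) ==>
  (ny2 i == ny2 j) ==> (i == j)) (iota 0 21)) (iota 0 21) by vm_compute.
have hp : all (fun i => nk2 i == block_weight 11 (ncl2 i) (nx2 i)
  * block_weight 10 (ncl2 i) (ny2 i) * block_weight 9 (ncl2 i) (nz2 i))%N (iota 0 21).
  by vm_compute.
have sum2 s : (x2 s + y2 s + z2 s = c (cl2 s))%N.
  by rewrite val_cl2; exact: (eqP (iota_all hs s)).
have inj2 s s' : cl2 s = cl2 s' -> x2 s = x2 s' -> y2 s = y2 s' -> s = s'.
  move=> /(congr1 val); rewrite !val_cl2 => /eqP e1 /eqP e2 /eqP e3.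
  exact/val_inj/eqP/(implyP (implyP (implyP (iota_all (iota_all hi s) s') e1) e2) e3).
have prod2 s : (k2 s = block_weight 11 (cl2 s) (x2 s) * block_weight 10 (cl2 s) (y2 s)
    * block_weight 9 (cl2 s) (z2 s))%N.
  by rewrite val_cl2; exact: (eqP (iota_all hp s)).
have [N0 hN0] := @laser R _ _ cl2 x2 y2 z2 (fun a => c a) k2
  (fun a => block_weight 11 a) (fun a => block_weight 10 a) (fun a => block_weight 9 a)
  (A2 R) theta (iota_all hk) sum2 (iota_all hx) (iota_all hy) inj2 prod2
  (@fiber2 R nx2 isT erefl) (@fiber2 R ny2 isT erefl) (@fiber2 R nz2 isT erefl) th1.
exists N0 => N hN N_gt0 n t ht.
have [a|S [ST SM Sc]] := hN0 N hN N_gt0 _ t; first by rewrite class_size2.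
by exists S; rewrite -class_weight2.
Qed.

Lemma exprn_powR_le (x r s : R) N : 1 <= x -> r <= s -> (x `^ r) ^+ N <= (x ^+ N) `^ s.
Proof.
move=> x1 rs; have x0 : 0 <= x := le_trans ler01 x1.
rewrite -powR_mulrn ?powR_ge0 // powRAC powR_mulrn //.
by apply: ler_powR rs; exact: exprn_ege1.
Qed.

Lemma combine_levels (a1 a2 w1 w2 th m P : R) :
  0 <= a1 -> 0 <= w2 -> 0 <= th -> w1 <= a1 * m * th -> w2 * m <= a2 * th * P ->
  w1 * w2 <= a1 * a2 * th ^+ 2 * P.
Proof.
move=> a10 w20 th0 h1 h2; apply: le_trans (ler_wpM2r w20 h1) _.
rewrite [leLHS](_ : _ = a1 * th * (w2 * m)); last by ring.
rewrite [leRHS](_ : _ = a1 * th * (a2 * th * P)); last by ring.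
by apply: ler_wpM2l => //; exact: mulr_ge0.
Qed.

(** Of the three factors [th ^+ N] contained in the gain, two pay for the losses of the two
    extractions and the third exceeds the constant 8. *)
Lemma growth_contradiction (a g w v th P : R) N :
  0 < a -> 0 < g -> 0 < w -> 0 < v -> 0 < th -> th ^+ 3 = w * v / (a * g) ->
  w ^+ N <= a ^+ N * (th ^+ N) ^+ 2 * P -> P * v ^+ N <= 8 * g ^+ N -> 9 <= th ^+ N -> False.
Proof.
move=> a0 g0 w0 v0 th0 e low up th9.
have thN : 0 < th ^+ N by rewrite exprn_gt0.
have aN : 0 < a ^+ N by rewrite exprn_gt0.
have gN : 0 < g ^+ N by rewrite exprn_gt0.
have vN : 0 < v ^+ N by rewrite exprn_gt0.
have eN : (th ^+ N) ^+ 3 * (a ^+ N * g ^+ N) = w ^+ N * v ^+ N.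
  by rewrite -exprM mulnC exprM e -!exprMn divfK // gt_eqF // mulr_gt0.
have h1 : w ^+ N * v ^+ N <= a ^+ N * (th ^+ N) ^+ 2 * (P * v ^+ N).
  by rewrite mulrA ler_pM2r.
have h2 : a ^+ N * (th ^+ N) ^+ 2 * (P * v ^+ N) <= a ^+ N * (th ^+ N) ^+ 2 * (8 * g ^+ N).
  by rewrite ler_pM2l // mulr_gt0 // exprn_gt0.
have := le_trans h1 h2; rewrite -eN.
rewrite [leLHS](_ : _ = (a ^+ N * (th ^+ N) ^+ 2 * g ^+ N) * th ^+ N); last by ring.
rewrite [leRHS](_ : _ = (a ^+ N * (th ^+ N) ^+ 2 * g ^+ N) * 8); last by ring.
rewrite ler_pM2l; last by rewrite !mulr_gt0 // exprn_gt0.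
by lra.
Qed.

Lemma tau_le (tau : R) : satisfies_inequalities cc_commutative tau -> tau <= 2376 / 1000.
Proof.
move=> Htau; rewrite leNgt; apply/negP => big.
have tau3 : 792 / 1000 <= tau / 3 by lra.
have A1p : 0 < A1 R := (ln_wprod R (l := [:: (80, 80); (272, 272); (256, 256); (16, 16)]%N) isT).1.
have A2p : 0 < A2 R := (ln_wprod R (l := [:: (8, 48); (64, 448); (2, 4); (124, 124)]%N) isT).1.
have W1p : 0 < W1 R := (ln_wprod R (l := [:: (624, 624)]%N) isT).1.
have W2p : 0 < W2 R := (ln_wprod R (l := [:: (8, 48); (64, 192); (128, 384)]%N) isT).1.
have Vp : 0 < V R := (ln_wprod R (l := [:: (12, 48); (38, 192); (6, 12); (36, 372)]%N) isT).1.
have G1p : 0 < G1 R := (ln_wprod R (l := [:: (64, 624)]%N) isT).1.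
have G1E M : G1 R ^+ M = 64%:R ^+ (M * 624) by rewrite /G1 /wprod big_seq1 -exprM mulnC.
have gain_R := gain R; have vol_R := volume_wprod R.
(* The cube root of the gain [rho] is taken for [theta]. *)
have theta_ex (r : R) : 1 < r -> exists2 theta, 1 < theta & theta ^+ 3 = r.
  move=> r1; exists (expR (ln r / 3)); first by rewrite expR_gt1 divr_gt0 // ln_gt0.
  by rewrite -expRM_natl mulrC divfK // lnK // posrE; exact: lt_trans r1.
have la1 := laser1; have la2 := laser2.
(* Made abstract because conversion would otherwise unfold powers such as [624 ^+ 624]. *)
move: (A1 R) (A2 R) (W1 R) (W2 R) (V R) (G1 R) A1p A2p W1p W2p Vp G1p G1E gain_R vol_R la1 la2
  => a1 a2 w1 w2 vv g1 A1p A2p W1p W2p Vp G1p G1E gain_R vol_R la1 la2.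
set v := vv `^ (792 / 1000) in gain_R; have vp : 0 < v by exact: powR_gt0.
pose rho := (w1 * w2 * v) / (a1 * a2 * g1).
have den : 0 < a1 * a2 * g1 by rewrite !mulr_gt0.
have rho1 : 1 < rho by rewrite ltr_pdivlMr // mul1r.
have [theta th1 th3] := theta_ex rho rho1.
have [N1 hN1] := la1 theta th1; have [N2 hN2] := la2 theta th1.
have [N3 hN3] := poly_le_exp 0 (ler0n R 9) th1.
have [N [ge1 ge2 ge3 N0]] : exists N, [/\ N1 <= N, N2 <= N, N3 <= N & 0 < N]%N.
  by exists (N1 + N2 + N3).+1; split=> //; apply: leqW; rewrite ?leq_addl // -addnA
    ?leq_addr // addnCA leq_addr.
have [S1 [S1T S1M S1c]] := hN1 N ge1 N0.
have exS2 (t : {ffun 'I_(N * 624) -> Sym1}) : exists S : {set {ffun 'I_(N * 624) -> Sym2}},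
    t \in S1 -> [/\ S \subset type_class cl2 t (fun s => N * k2 s)%N,
          matched cl2 x2 y2 z2 t S
        & w2 ^+ N <= a2 ^+ N * #|S|%:R * theta ^+ N].
  have [tS|tS] := boolP (t \in S1); last by exists finset.set0.
  have [a|S hS] := hN2 N ge2 N0 _ t; last by exists S.
  by have := fintype.subsetP S1T _ tS; rewrite inE => /andP[_ /forallP/(_ a)/eqP].
have [S2 hS2] := choice exS2.
have S2T t (h : t \in S1) := let: And3 h1 _ _ := hS2 t h in h1.
have S2M t (h : t \in S1) := let: And3 _ h1 _ := hS2 t h in h1.
have S2c t (h : t \in S1) := let: And3 _ _ h1 := hS2 t h in h1.
have stp := @words_stpp _ N S1 S2 erefl S1T S1M S2M.
have vol := @words_vol _ N S1 S2 S2T.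
set P := #|words S1 S2|%:R : R.
have cardI : #|{: {s | s \in words S1 S2}}| = #|words S1 S2| by rewrite card_sig; apply: eq_card.
have th0 : 0 < theta by exact: lt_trans th1.
have low : w1 ^+ N * w2 ^+ N <= a1 ^+ N * a2 ^+ N * (theta ^+ N) ^+ 2 * P.
  apply: combine_levels S1c _; try exact/ltW/exprn_gt0.
  rewrite /P (card_words S2T) natr_sum mulr_sumr mulr_natr -sumr_const.
  by apply: ler_sum => t tS; rewrite mulrAC; exact: S2c.
have P0 : (0 < #|words S1 S2|)%N.
  rewrite lt0n; apply/eqP => e; move: low; rewrite /P e mulr0 leNgt.
  by rewrite mulr_gt0 ?exprn_gt0.
have V0 : (0 < (\prod_(s < 21) nvol s ^ nk2 s) ^ N)%N.
  by rewrite expn_gt0 -(ltr_nat R) vol_R Vp.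
have := stpp_bound Htau stp vol V0; rewrite cardI => /(_ P0).
rewrite natrX vol_R -/P => up.
have {}up : P * v ^+ N <= 8 * g1 ^+ N.
  apply: (@le_trans _ _ (P * (vv ^+ N) `^ (tau / 3))).
    apply: ler_wpM2l; first exact: ler0n.
    apply: exprn_powR_le tau3; by rewrite -vol_R ler1n -(ltr_nat R) vol_R.
  apply: (le_trans up); apply: ler_wpM2l; first exact: ler0n.
  by rewrite card_ffun card_prod !card_ord natrX G1E.
have := hN3 N ge3; rewrite expr0 mulr1 => th9.
apply: (growth_contradiction (mulr_gt0 A1p A2p) G1p (mulr_gt0 W1p W2p) vp th0 _ _ up th9).
  exact: th3.
by rewrite !exprMn.
Qed.

End FinalBound.

Theorem theorem5p6 (R : realType) (c d : R)
    (hcd : (c, d) \in [:: (248 / 100, 272 / 100);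
                          (241 / 100, 262 / 100);
                          (2376 / 1000, 2564 / 1000)]) :
  exists F : coherent_configuration -> Prop,
    [/\ forall D, F D -> cc_commutative D,
        proves_s_rank_bound F (fun tau : R => tau <= c),
        proves_omega_bound F (fun w : R => w <= d)
      & satisfies_inequalities F (omega_s R) ->
        omega R <= (3 * omega_s R - 2) / 2 ->
        omega_s R <= c /\ omega R <= d].
Proof.
(* The last pair is the strongest, and [(3 * 2.376 - 2) / 2 = 2.564] exactly, so the family of all
   commutative configurations serves every pair. *)
have [c_ge d_ge] : 2376 / 1000 <= c /\ 2564 / 1000 <= d.
  by move: hcd; rewrite !inE => /or3P[] /eqP[-> ->]; split; lra.
have bound tau : satisfies_inequalities cc_commutative tau -> tau <= c.
  by move=> /tau_le h; exact: le_trans h c_ge.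
have bound_omega tau w : satisfies_inequalities cc_commutative tau ->
    w <= (3 * tau - 2) / 2 -> w <= d.
  by move=> /tau_le h hw; lra.
exists cc_commutative; split => // h hw.
by split; [exact: bound | exact: bound_omega h hw].
Qed.
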